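(* There is a polynomial-time procedure that turns every nice, safe-centralized, and $\alpha$-homogenous GFG-tNCW $\mathcal{B}$ into a GFG-tNCW $\mathcal{C}$ with $L(\mathcal{C})=L(\mathcal{B})$ that is nice, safe-centralized, safe-minimal, and $\alpha$-homogenous.
   Context: A tNCW is $\mathcal{A}=\langle \Sigma,Q,q_0,\delta,\alpha\rangle$ with finite alphabet $\Sigma$, finite state set $Q$, initial state $q_0$, total transition function $\delta:Q\times\Sigma\to 2^Q\setminus\{\emptyset\}$ with transition relation $\Delta=\{\langle q,\sigma,s\rangle: s\in\delta(q,\sigma)\}$, and $\alpha\subseteq\Delta$ ($\alpha$-transitions; the rest are $\bar\alpha$-transitions). $\delta^{\alpha}(q,\sigma)$, $\delta^{\bar\alpha}(q,\sigma)$ denote the $\sigma$-successors of $q$ via $\alpha$- resp. $\bar\alpha$-transitions. A run on $w=\sigma_1\sigma_2\cdots$ is $r_0r_1\cdots$ with $r_0=q_0$, $r_{i+1}\in\delta(r_i,\sigma_{i+1})$, accepting iff it traverses $\alpha$-transitions only finitely often; $L(\mathcal{A})$ is the set of accepted words. $\mathcal{A}^q$ is $\mathcal{A}$ with initial state $q$. $\mathcal{A}$ is GFG if there is $f:\Sigma^*\to Q$ with $f(\epsilon)=q_0$, $\langle f(u),\sigma,f(u\sigma)\rangle\in\Delta$ for all $u,\sigma$, and for every $w\in L(\mathcal{A})$ the run $f(w[1,0]),f(w[1,1]),\dots$ is accepting; a state $q$ is GFG if $\mathcal{A}^q$ is. A run is safe if it uses no $\alpha$-transition; $L_{safe}(\mathcal{A}^q)$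 is the set of infinite words with a safe run from $q$. $q\sim s$ iff $L(\mathcal{A}^q)=L(\mathcal{A}^s)$; $q\approx s$ iff $q\sim s$ and $L_{safe}(\mathcal{A}^q)=L_{safe}(\mathcal{A}^s)$; $q\precsim s$ iff $q\sim s$ and $L_{safe}(\mathcal{A}^q)\subseteq L_{safe}(\mathcal{A}^s)$. Safe components are the SCCs of the graph on $Q$ with an edge $q\to q'$ iff some $\bar\alpha$-transition $\langle q,\sigma,q'\rangle$ exists. $\mathcal{A}$ is semantically deterministic if any two $\sigma$-successors of any state are $\sim$-equivalent; safe deterministic if $|\delta^{\bar\alpha}(q,\sigma)|\le1$ always; normal if a path of $\bar\alpha$-transitions from $q$ to $s$ implies one from $s$ to $q$. A GFG-tNCW is nice if all states are reachable and GFG and it is normal, safe deterministic and semantically deterministic. It is safe-centralized if $q\precsim s$ implies $q,s$ are in the same safe component; safe-minimal if no two distinct states $q,s$ satisfy $q\approx s$; $\alpha$-homogenous if for all $q,\sigma$, $\delta^\alpha(q,\sigma)=\emptyset$ or $\delta^{\bar\alpha}(q,\sigma)=\emptyset$. *)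

(* Defs.v *)
From mathcomp Require Import all_boot.
Set Implicit Arguments.
Unset Strict Implicit.
Unset Printing Implicit Defensive.

Record tNCW (Sigma Q : finType) := TNCW {
  init : Q;
  delta : Q -> Sigma -> {set Q};
  alpha : {set Q * Sigma * Q};
  delta_total : forall q a, delta q a != set0;
  alpha_sub : forall q a s, (q, a, s) \in alpha -> s \in delta q a
}.

Section Automata.
Variables Sigma Q : finType.
Implicit Types (A : tNCW Sigma Q) (q s : Q) (a : Sigma).
(** The letter at position [i] of the paper's w = s_1 s_2 ... is [w i.-1]. *)
Implicit Types (w : nat -> Sigma) (r : nat -> Q).

Definition with_init A q : tNCW Sigma Q :=
  TNCW q (@delta_total _ _ A) (@alpha_sub _ _ A).

Definition delta_alpha A q a : {set Q} :=
  [set s in delta A q a | (q, a, s) \in alpha A].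

Definition delta_safe A q a : {set Q} :=
  [set s in delta A q a | (q, a, s) \notin alpha A].

Definition is_run A w r : Prop :=
  r 0 = init A /\ forall i, r i.+1 \in delta A (r i) (w i).

Definition accepting A w r : Prop :=
  exists N, forall i, N <= i -> (r i, w i, r i.+1) \notin alpha A.

Definition lang A w : Prop := exists r, is_run A w r /\ accepting A w r.

Definition lang_safe A w : Prop :=
  exists r, is_run A w r /\ forall i, (r i, w i, r i.+1) \notin alpha A.

(** [mkseq w i] is the prefix of [w] of length [i]. *)
Definition GFG A : Prop :=
  exists f : seq Sigma -> Q,
    [/\ f [::] = init A,
        forall u a, f (rcons u a) \in delta A (f u) a
      & forall w, lang A w -> accepting A w (fun i => f (mkseq w i))].

Definition lang_equiv A q s : Prop :=
  forall w, lang (with_init A q) w <-> lang (with_init A s) w.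

Definition strong_equiv A q s : Prop :=
  lang_equiv A q s /\
  forall w, lang_safe (with_init A q) w <-> lang_safe (with_init A s) w.

Definition subsafe_equiv A q s : Prop :=
  lang_equiv A q s /\
  forall w, lang_safe (with_init A q) w -> lang_safe (with_init A s) w.

Definition edge A : rel Q := fun q s => [exists a, s \in delta A q a].

Definition safe_edge A : rel Q := fun q s => [exists a, s \in delta_safe A q a].

Definition reachable A q : bool := connect (edge A) (init A) q.

Definition same_safe_component A q s : bool :=
  connect (safe_edge A) q s && connect (safe_edge A) s q.

Definition semantically_deterministic A : Prop :=
  forall q a s s', s \in delta A q a -> s' \in delta A q a -> lang_equiv A s s'.

Definition safe_deterministic A : Prop :=
  forall q a, #|delta_safe A q a| <= 1.

Definition normal A : Prop :=
  forall q s, connect (safe_edge A) q s -> connect (safe_edge A) s q.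

Definition nice A : Prop :=
  [/\ forall q, reachable A q,
      forall q, GFG (with_init A q),
      normal A,
      safe_deterministic A
    & semantically_deterministic A].

Definition safe_centralized A : Prop :=
  forall q s, subsafe_equiv A q s -> same_safe_component A q s.

Definition safe_minimal A : Prop :=
  forall q s, q != s -> ~ strong_equiv A q s.

Definition alpha_homogenous A : Prop :=
  forall q a, delta_alpha A q a = set0 \/ delta_safe A q a = set0.

End Automata.

(** The unit-cost RAM of Cook and Reckhow (Time bounded random access machines,
    1973), over natural numbers.  Addition and truncated subtraction are the
    only arithmetic operations: without multiplication, registers have at most
    linearly many bits in the running time and in the bit length of the input,
    so that polynomial time is the same as for Turing machines. *)

Inductive instr :=
| IConst (i c : nat)      (* X_i := c *)
| IAdd (i j k : nat)      (* X_i := X_j + X_k *)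
| ISub (i j k : nat)      (* X_i := X_j - X_k, truncated at 0 *)
| ILoad (i j : nat)       (* X_i := X_(X_j) *)
| IStore (i j : nat)      (* X_(X_i) := X_j *)
| IJump (j m : nat)       (* if X_j > 0 then go to m *)
| IRead (i : nat)         (* X_i := next input, 0 at the end of the input *)
| IPrint (i : nat).       (* append X_i to the output *)

Definition program := seq instr.

Record config := Config {
  pc : nat;
  regs : nat -> nat;
  input : seq nat;
  output : seq nat
}.

Definition upd (X : nat -> nat) (i v : nat) : nat -> nat :=
  fun j => if j == i then v else X j.

Definition exec (i : instr) (c : config) : config :=
  let: Config l X x y := c in
  match i with
  | IConst i v => Config l.+1 (upd X i v) x y
  | IAdd i j k => Config l.+1 (upd X i (X j + X k)) x y
  | ISub i j k => Config l.+1 (upd X i (X j - X k)) x y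
  | ILoad i j => Config l.+1 (upd X i (X (X j))) x y
  | IStore i j => Config l.+1 (upd X (X i) (X j)) x y
  | IJump j m => Config (if 0 < X j then m else l.+1) X x y
  | IRead i => Config l.+1 (upd X i (head 0 x)) (behead x) y
  | IPrint i => Config l.+1 X x (rcons y (X i))
  end.

(** The machine halts when [pc] leaves the program; halted configurations are
    fixed by [step]. *)
Definition halted (P : program) (c : config) : bool := size P <= pc c.

Definition step (P : program) (c : config) : config :=
  if onth P (pc c) is Some i then exec i c else c.

Definition start (x : seq nat) : config := Config 0 (fun=> 0) x [::].

Definition outputs_within (P : program) (t : nat) (x y : seq nat) : Prop :=
  let c := iter t (step P) (start x) in halted P c /\ output c = y.

(** The sizes of the state space and of the alphabet, the initial state, and
    then the transition table in row-major order.  States and letters are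
    numbered by [enum]; all entries are bounded by max(2, |Q|, |Sigma|). *)

Section Encoding.
Variables Sigma Q : finType.
Implicit Type A : tNCW Sigma Q.

Definition transition_code A (q : Q) (a : Sigma) (s : Q) : nat :=
  if s \in delta_safe A q a then 1
  else if s \in delta_alpha A q a then 2 else 0.

Definition encode A : seq nat :=
  [:: #|Q|; #|Sigma|; val (enum_rank (init A))] ++
  [seq transition_code A qa.1 qa.2 s |
     qa <- [seq (q, a) | q <- enum Q, a <- enum Sigma], s <- enum Q].

End Encoding.

(* Main.v *)
Require Import Defs.
From mathcomp Require Import all_boot.
From mathcomp Require Import zify.
From Stdlib Require Import Classical.

Set Implicit Arguments.
Unset Strict Implicit.
Unset Printing Implicit Defensive.

(** Two states are strongly equivalent iff neither their languages nor their
    safe languages are separated by a word.  Separation of q from s is a game on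
    pairs of states: Spoiler moves q along safe transitions, Duplicator answers
    on s with the same letter, and Spoiler wants infinitely many alpha-transitions
    on the side of s.  [spoil_once setT] (one alpha-transition, or none possible,
    suffices) describes non-inclusion of safe languages, its greatest fixpoint
    [spoil_core] the pairs with L_safe(q) not included in L(s), and backward
    reachability of the core non-inclusion of languages: since s is GFG, its
    strategy turns a winning play of Spoiler into a rejected word.  All these are
    iterations of first-order definable operators on pairs of states, hence
    computable in polynomial time.  The automaton C is the quotient by strong equivalence, with the
    transitions of all members of a class, so that a GFG strategy of B projects
    to one of C; normality and safe determinism make the safe transitions of
    equivalent states match.

    The machine program is the compilation of a program all of whose loops run at
    most |Q| + |Sigma| times, so that its running time is polynomial by induction
    on its syntax. *)

(** * Languages and safe runs *)

Section Words.
Variables (Sigma Q : finType) (A : tNCW Sigma Q).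
Implicit Types (q s : Q) (a : Sigma) (w : nat -> Sigma).

Definition tl w : nat -> Sigma := fun i => w i.+1.

Definition wcons a w : nat -> Sigma := fun i => if i is j.+1 then w j else a.

Lemma iter_tlE w i : iter i tl w 0 = w i.
Proof. by elim: i w => // i IH w; rewrite iterSr IH. Qed.

Lemma in_delta_safe q a s :
  (s \in delta_safe A q a) = (s \in delta A q a) && ((q, a, s) \notin alpha A).
Proof. by rewrite inE. Qed.

Lemma in_delta_alpha q a s : (s \in delta_alpha A q a) = ((q, a, s) \in alpha A).
Proof. by rewrite inE andb_idl // => /alpha_sub. Qed.

Lemma delta_safe_sub q a s : s \in delta_safe A q a -> s \in delta A q a.
Proof. by rewrite in_delta_safe => /andP[]. Qed.

Lemma lang_step q w :
  lang (with_init A q) w <->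
  exists2 s, s \in delta A q (w 0) & lang (with_init A s) (tl w).
Proof.
split=> [[r [[/= r0 rd] [N rN]]]|[s sd [r [[/= r0 rd] [N rN]]]]].
  exists (r 1); first by rewrite -r0.
  exists (fun i => r i.+1); split; first by split=> // i; apply: rd.
  by exists N => i lei; apply: rN; apply: leqW.
exists (fun i => if i is j.+1 then r j else q); split.
  by split=> // -[|i] /=; [rewrite r0 | apply: rd].
by exists N.+1 => -[|i] // lei; apply: (rN i).
Qed.

Lemma lang_safe_step q w :
  lang_safe (with_init A q) w <->
  exists2 s, s \in delta_safe A q (w 0) & lang_safe (with_init A s) (tl w).
Proof.
split=> [[r [[/= r0 rd] rN]]|[s]].
  exists (r 1); first by rewrite in_delta_safe -r0 rd; apply: rN.
  by exists (fun i => r i.+1); split=> [|i]; [split=> // i; apply: rd | apply: rN].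
rewrite in_delta_safe => /andP[sd sN] [r [[/= r0 rd] rN]].
exists (fun i => if i is j.+1 then r j else q); split.
  by split=> // -[|i] /=; [rewrite r0 | apply: rd].
by case=> [|i]; [rewrite /= r0 | apply: (rN i)].
Qed.

Lemma lang_safe_sub q w :
  lang_safe (with_init A q) w -> lang (with_init A q) w.
Proof. by case=> r [rr rN]; exists r; split=> //; exists 0. Qed.

(** Cutting a run behind its last alpha-transition leaves a safe run on the remaining word. *)
Lemma accepting_safe_suffix r w :
  (forall i, r i.+1 \in delta A (r i) (w i)) ->
  accepting A w r ->
  exists i, lang_safe (with_init A (r i)) (iter i tl w).
Proof.
move=> rd [N rN]; exists N, (fun i => r (N + i)).
have iterE i : iter N tl w i = w (N + i).
  by rewrite -[LHS]iter_tlE -iterD addnC iter_tlE.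
split; first by split=> [|i]; rewrite /= ?addn0 // addnS iterE; apply: rd.
by move=> i; rewrite iterE addnS; apply: rN; apply: leq_addr.
Qed.

Hypothesis safe_det : safe_deterministic A.

Lemma delta_safe_uniq q a s s' :
  s \in delta_safe A q a -> s' \in delta_safe A q a -> s = s'.
Proof. by move=> ss ss'; apply: (card_le1_eqP (safe_det q a)). Qed.

(** The default [q] only makes the function total; a blocked run is recognised by
    [safe_succ q a \notin delta_safe A q a]. *)
Definition safe_succ q a : Q := odflt q [pick s in delta_safe A q a].

Lemma safe_succE q a s : s \in delta_safe A q a -> safe_succ q a = s.
Proof.
rewrite /safe_succ; case: pickP => [s' ss' ss|->//].
exact: delta_safe_uniq ss' ss.
Qed.

Fixpoint safe_run q w i : Q :=
  if i is j.+1 then safe_run (safe_succ q (w 0)) (tl w) j else q.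

Lemma safe_runS q w i : safe_run q w i.+1 = safe_succ (safe_run q w i) (w i).
Proof. by elim: i q w => // i IH q w /=; rewrite -IH. Qed.

Lemma safe_run_lang q w :
  (forall i, safe_succ (safe_run q w i) (w i) \in delta_safe A (safe_run q w i) (w i)) ->
  lang_safe (with_init A q) w.
Proof.
move=> H; exists (safe_run q w); split; first split=> //.
  by move=> i; rewrite safe_runS; apply: delta_safe_sub.
by move=> i; rewrite safe_runS; have := H i; rewrite in_delta_safe => /andP[].
Qed.

(** Safe determinism names the run in advance, namely [safe_run q w], so the existential steps need
    no choice: the invariant merely follows that run. *)
Lemma lang_safe_coind (P : Q -> (nat -> Sigma) -> Prop) :
  (forall q w, P q w -> exists2 s, s \in delta_safe A q (w 0) & P s (tl w)) ->
  forall q w, P q w -> lang_safe (with_init A q) w.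
Proof.
move=> Pstep q w Pqw; apply: safe_run_lang => i.
have : P (safe_run q w i) (iter i tl w).
  elim: i => // i /Pstep[s]; rewrite iter_tlE => /safe_succE.
  by rewrite safe_runS => ->.
by move=> /Pstep[s]; rewrite iter_tlE => ss _; rewrite (safe_succE ss).
Qed.

Hypothesis norm : normal A.

(** Normality puts each safe transition on a cycle of safe transitions, so its target has a safe
    successor, which is again such a target: the run never gets stuck. *)
Lemma lang_safe_inhab q a s :
  s \in delta_safe A q a -> exists w, lang_safe (with_init A s) w.
Proof.
move=> ss.
pose live x := [exists y, safe_edge A x y].
pose nxt x := odflt a [pick b | [exists y, y \in delta_safe A x b]].
have nxtP x : live x -> exists2 y, y \in delta_safe A x (nxt x) & live y.
  move=> /existsP[y0 /existsP[b yb]].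
  have [y yx] : exists y, y \in delta_safe A x (nxt x).
    rewrite /nxt; case: pickP => [c /existsP//|/(_ b)/existsP[]].
    by exists y0.
  exists y => //.
  have exy : safe_edge A x y by apply/existsP; exists (nxt x).
  (* An empty way back means that the transition is a safe loop, which itself leaves [y]. *)
  have /connectP[[|z p] /= pth lst] := norm (connect1 exy).
    by apply/existsP; exists y; rewrite -[X in safe_edge A X _]lst.
  by case/andP: pth => yz _; apply/existsP; exists z.
have ls : live s.
  have eqs : safe_edge A q s by apply/existsP; exists a.
  have /connectP[[|z p] /= pth lst] := norm (connect1 eqs).
    by apply/existsP; exists s; rewrite -[X in safe_edge A X _]lst.
  by case/andP: pth => yz _; apply/existsP; exists z.
pose r i := iter i (fun x => safe_succ x (nxt x)) s.
have lr i : live (r i).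
  by elim: i => //= i /nxtP[y /safe_succE ->].
exists (fun i => nxt (r i)), r; split; first split=> //.
  move=> i /=; have [y yx _] := nxtP _ (lr i).
  by rewrite (safe_succE yx) delta_safe_sub.
move=> i /=; have [y yx _] := nxtP _ (lr i).
by rewrite (safe_succE yx); move: yx; rewrite in_delta_safe => /andP[].
Qed.

End Words.

Arguments tl {Sigma} w i.

(** * Language inclusion as a fixpoint *)

Lemma iter_mono (T : finType) (F G : {set T} -> {set T}) m (X Y : {set T}) :
  (forall U V : {set T}, U \subset V -> F U \subset G V) ->
  X \subset Y -> iter m F X \subset iter m G Y.
Proof. by move=> FG XY; elim: m => //= m; apply: FG. Qed.

Lemma iter_fixset (T : finType) (F : {set T} -> {set T}) m :
  {homo F : X Y / X \subset Y} -> #|T| <= m -> iter m F set0 = fixset F.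
Proof. by move=> Fm /subnK<-; rewrite iterD fixsetKn. Qed.

(** Complementation turns the descending iteration from [setT] into the ascending iteration of the
    dual operator from [set0]. *)
Lemma iter_cofixset (T : finType) (F : {set T} -> {set T}) m :
  {homo F : X Y / X \subset Y} -> #|T| <= m ->
  F (iter m F setT) = iter m F setT.
Proof.
move=> Fm lem.
have -> : iter m F setT = ~: iter m (funsetC F) set0.
  by elim: m {lem} => [|m IH] /=; rewrite ?setC0 // /funsetC setCK IH.
have Fm' : {homo (funsetC F) : X Y / X \subset Y}.
  by move=> X Y XY; rewrite /funsetC setCS Fm // setCS.
by rewrite iter_fixset // -[in RHS](fixsetK Fm') /funsetC setCK.
Qed.

Section Inclusion.
Variables (Sigma Q : finType) (A : tNCW Sigma Q).
Implicit Types (q s : Q) (a : Sigma) (w : nat -> Sigma).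

Definition lang_incl q s :=
  forall w, lang (with_init A q) w -> lang (with_init A s) w.

Definition lang_safe_incl q s :=
  forall w, lang_safe (with_init A q) w -> lang_safe (with_init A s) w.

(** Spoiler's step: he reaches [Z] if Duplicator has a safe answer, and [Y] whatever
    alpha-transition she takes otherwise. *)
Definition spoil (Y Z : {set Q * Q}) : {set Q * Q} :=
  [set p : Q * Q | [exists a, exists q' in delta_safe A p.1 a, forall s',
     ((s' \in delta_safe A p.2 a) ==> ((q', s') \in Z)) &&
     ((s' \in delta_alpha A p.2 a) ==> ((q', s') \in Y))]].

(** Existential on both sides: under semantic determinism inclusion passes to all pairs of
    successors ([lang_incl_step]), so a single failing pair refutes it. *)
Definition co_reach (Y N : {set Q * Q}) : {set Q * Q} :=
  [set p : Q * Q | (p \in Y) || [exists a, exists q' in delta A p.1 a,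
     exists s' in delta A p.2 a, (q', s') \in N]].

Lemma spoilP (Y Z : {set Q * Q}) q s :
  reflect (exists a q', [/\ q' \in delta_safe A q a,
              forall s', s' \in delta_safe A s a -> (q', s') \in Z
            & forall s', s' \in delta_alpha A s a -> (q', s') \in Y])
          ((q, s) \in spoil Y Z).
Proof.
rewrite inE; apply: (iffP existsP) => [[a /exists_inP[q' qq' /forallP H]]|].
  exists a, q'; split=> // s' ss'; have /andP[/implyP H1 /implyP H2] := H s'.
    exact: H1.
  exact: H2.
case=> a [q' [qq' H1 H2]]; exists a; apply/exists_inP; exists q' => //.
by apply/forallP=> s'; apply/andP; split; apply/implyP; [apply: H1 | apply: H2].
Qed.

Lemma spoil_mono (Y Y' Z Z' : {set Q * Q}) :
  Y \subset Y' -> Z \subset Z' -> spoil Y Z \subset spoil Y' Z'.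
Proof.
move=> /subsetP YY /subsetP ZZ; apply/subsetP => -[q s] /spoilP[a [q' [qq' H1 H2]]].
by apply/spoilP; exists a, q'; split=> // s' /[dup] ? ?; [apply/ZZ/H1 | apply/YY/H2].
Qed.

Variable m : nat.
Hypothesis m_large : #|{: Q * Q}| <= m.

(** The number of rounds is a parameter: from [#|{: Q * Q}|] on it does not matter, and the machine
    uses the square of [#|Q| + #|Sigma|], which nested loops can count. *)
Definition spoil_once Y := iter m (spoil Y) set0.

Definition spoil_core := iter m spoil_once setT.

Definition non_incl := iter m (co_reach spoil_core) set0.

Lemma spoil_onceE Y : spoil Y (spoil_once Y) = spoil_once Y.
Proof.
have mono : {homo spoil Y : X Z / X \subset Z} by move=> X Z; apply: spoil_mono.
by rewrite /spoil_once iter_fixset // fixsetK.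
Qed.

Lemma spoil_once_mono : {homo spoil_once : X Y / X \subset Y}.
Proof. by move=> X Y XY; apply: iter_mono => // U V; apply: spoil_mono. Qed.

Lemma spoil_coreE : spoil_once spoil_core = spoil_core.
Proof. by apply: iter_cofixset => //; apply: spoil_once_mono. Qed.

Lemma co_reach_mono Y : {homo co_reach Y : X Z / X \subset Z}.
Proof.
move=> X Z /subsetP XZ; apply/subsetP=> -[q s]; rewrite !inE => /orP[->//|].
move=> /existsP[a /exists_inP[q' qq' /exists_inP[s' ss' /XZ H]]]; apply/orP; right.
by apply/existsP; exists a; apply/exists_inP; exists q' => //; apply/exists_inP; exists s'.
Qed.

Lemma non_inclE : co_reach spoil_core non_incl = non_incl.
Proof. by rewrite /non_incl iter_fixset ?fixsetK //; apply: co_reach_mono. Qed.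

(** * Soundness and completeness of the fixpoints *)

Hypothesis safe_det : safe_deterministic A.
Hypothesis norm : normal A.

(** With [Y] equal to [setT], every alpha-answer loses for Duplicator. The stages of the fixpoint
    spell a separating word; outside the fixpoint Duplicator always has a safe answer, which is a
    coinductive invariant. *)
Lemma spoil_onceTP q s :
  reflect (exists w, lang_safe (with_init A q) w /\ ~ lang_safe (with_init A s) w)
          ((q, s) \in spoil_once setT).
Proof.
apply: (iffP idP).
  rewrite /spoil_once; elim: {1}m q s => [|i IH] q s; first by rewrite inE.
  move=> /spoilP[a [q' [qq' Hs _]]].
  have [s' ss'|none] := pickP (mem (delta_safe A s a)).
    have [w [wq ws]] := IH _ _ (Hs _ ss'); exists (wcons a w); split.
      by apply/lang_safe_step; exists q'.
    by move=> /lang_safe_step[s'' /(delta_safe_uniq safe_det ss') <-].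
  (* Duplicator has no safe answer to [a], so any safe continuation from [q'] completes the word. *)
  have [w wq] := lang_safe_inhab safe_det norm qq'; exists (wcons a w); split.
    by apply/lang_safe_step; exists q'.
  by move=> /lang_safe_step[s'']; rewrite [_ \in _]none.
case=> w [wq ws]; apply/negPn/negP => qsN; move: ws; apply.
pose P s w := exists2 q, (q, s) \notin spoil_once setT & lang_safe (with_init A q) w.
apply: (lang_safe_coind safe_det (P := P)); last by exists q.
move=> {wq qsN}s {}w [{}q qsN /lang_safe_step[q' qq' wq']].
have [s' /andP[ss' qsN']|none] :=
  pickP [pred s' in delta_safe A s (w 0) | (q', s') \notin spoil_once setT].
  by exists s' => //; exists q'.
case/negP: qsN; rewrite -spoil_onceE; apply/spoilP; exists (w 0), q'.
split=> [//|s' ss'|s' _]; last by rewrite inE.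
by apply/negPn; have := none s'; rewrite /= ss' => /= ->.
Qed.

(** Spoiler plays [w]. The only safe run from [s] is blocked at position [i], whence the induction
    on [i]; each alpha-answer on the way leads to a pair that the rest of [w] still separates, hence
    into [Y]. *)
Lemma spoil_once_complete (Y : {set Q * Q}) i q s w :
  (forall q' s' w', lang_safe (with_init A q') w' -> ~ lang (with_init A s') w' ->
     (q', s') \in Y) ->
  lang_safe (with_init A q) w -> ~ lang (with_init A s) w ->
  safe_succ A (safe_run A s w i) (w i) \notin delta_safe A (safe_run A s w i) (w i) ->
  (q, s) \in spoil_once Y.
Proof.
move=> HY; elim: i q s w => [|i IHi] q s w wq ws Hi.
all: have [q' qq' wq'] := (lang_safe_step _ _ _).1 wq.
all: rewrite -spoil_onceE; apply/spoilP; exists (w 0), q'; split=> // s'.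
- by move=> ss'; rewrite /= (safe_succE safe_det ss') ss' in Hi.
- rewrite inE => /andP[ss' _]; apply: (HY _ _ (tl w)) => // ws'; apply: ws.
  by apply/lang_step; exists s'.
- move=> ss'; apply: (IHi _ _ (tl w)) => //.
    by move=> ws'; apply: ws; apply/lang_step; exists s'; rewrite ?delta_safe_sub.
  by rewrite /= (safe_succE safe_det ss') in Hi.
- rewrite inE => /andP[ss' _]; apply: (HY _ _ (tl w)) => // ws'; apply: ws.
  by apply/lang_step; exists s'.
Qed.

(** The pairs separated by such a word survive each round of the descending iteration: a rejected
    word has no safe run from [s], so the run is blocked somewhere and [spoil_once_complete]
    applies. *)
Lemma spoil_core_complete q s w :
  lang_safe (with_init A q) w -> ~ lang (with_init A s) w -> (q, s) \in spoil_core.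
Proof.
rewrite /spoil_core; elim: {1}m q s w => [|n IH] q s w wq ws; first by rewrite inE.
have [i Hi] : exists i, safe_succ A (safe_run A s w i) (w i)
    \notin delta_safe A (safe_run A s w i) (w i).
  apply: NNPP => H; apply: ws; apply/lang_safe_sub/safe_run_lang => // i.
  by apply/negPn/negP => Hi; apply: H; exists i.
exact: spoil_once_complete IH wq ws Hi.
Qed.

(** The stage at which a pair enters the inner fixpoint; it bounds how many safe answers Duplicator
    can give in a row. *)
Let rank := fix_order (spoil spoil_core).

(** The core is the inner fixpoint taken over itself. Spoiler's move at the stage of the pair sends
    safe answers to earlier stages, and alpha-answers back into the core at any stage. *)
Lemma spoil_core_step q s : (q, s) \in spoil_core ->
  exists a q', q' \in delta_safe A q a /\ forall s', s' \in delta A s a ->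
    (q', s') \in spoil_core /\
    ((s, a, s') \notin alpha A -> rank (q', s') < rank (q, s)).
Proof.
have mono : {homo spoil spoil_core : X Y / X \subset Y}.
  by move=> X Y; apply: spoil_mono.
have fixE : fixset (spoil spoil_core) = spoil_core.
  by rewrite -[RHS]spoil_coreE /spoil_once iter_fixset.
move=> qsY; have := qsY; rewrite -{1}fixE -in_iter_fix_orderE // -/rank.
case E: (rank (q, s)) => [|r]; first by rewrite inE.
move=> /spoilP[a [q' [qq' H1 H2]]]; exists a, q'; split=> // s' ss'.
have [al|nal] := boolP ((s, a, s') \in alpha A).
  by split=> //; apply: H2; rewrite in_delta_alpha.
have {H1}/H1 Hr : s' \in delta_safe A s a by rewrite in_delta_safe ss'.
split; first by rewrite -fixE; apply: subsetP Hr; apply: iter_sub_fix.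
by rewrite ltnS => _; apply: fix_order_small.
Qed.

Hypothesis all_GFG : forall q, GFG (with_init A q).

(** Spoiler's letters against the GFG strategy of s form a word rejected from s:
    between two alpha-transitions of the strategy, the rank decreases. *)
Lemma spoil_core_sound q s : (q, s) \in spoil_core ->
  exists w, lang_safe (with_init A q) w /\ ~ lang (with_init A s) w.
Proof.
move=> qsY; have [f [/= f0 fd fa]] := all_GFG s.
have [a0 _] := spoil_core_step qsY.
pose good (p : Q * Q) (c : Sigma * Q) := (c.2 \in delta_safe A p.1 c.1) &&
  [forall s', (s' \in delta A p.2 c.1) ==> ((c.2, s') \in spoil_core) &&
     (((p.2, c.1, s') \notin alpha A) ==> (rank (c.2, s') < rank p))].
pose move p := odflt (a0, q) [pick c | good p c].
have moveP p : p \in spoil_core -> good p (move p).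
  case: p => q1 s1 /spoil_core_step[a [q' [qq' H]]].
  rewrite /move; case: pickP => // /(_ (a, q')); rewrite /good /= qq' /=.
  case/negP; apply/forallP => s'; apply/implyP => /H[-> H'].
  exact/implyP.
(* A play stores the word so far, on which [f] yields the state of Duplicator, and the state of
   Spoiler. *)
pose play i := iter i (fun c : seq Sigma * Q =>
  let m := move (c.2, f c.1) in (rcons c.1 m.1, m.2)) ([::], q).
pose w i := (move ((play i).2, f (play i).1)).1.
have playE i : (play i).1 = mkseq w i.
  by elim: i => // i IH; rewrite mkseqS -IH.
have playY i : ((play i).2, f (play i).1) \in spoil_core.
  elim: i => [|i /moveP/andP[_ /forallP H]]; first by rewrite /= f0.
  by have /implyP := H (f (play i.+1).1); rewrite fd => /(_ isT)/andP[].
have playP i := andP (moveP _ (playY i)).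
exists w; split.
  exists (fun i => (play i).2); split; first split=> //= i.
    by have [+ _] := playP i; apply: delta_safe_sub.
  by move=> i; have [] := playP i; rewrite in_delta_safe => /andP[].
move=> /fa[N HN]; pose rk i := rank ((play i).2, f (play i).1).
have rk_dec i : N <= i -> rk i.+1 < rk i.
  move=> /HN; rewrite -!playE => nal; have [_ /forallP H] := playP i.
  by have /implyP := H (f (play i.+1).1); rewrite fd => /(_ isT)/andP[_ /implyP->].
(* If the word were accepted, the rank would fall at each step from [N] on, which is impossible for
   [(rk N).+1] steps. *)
have rk_bound i : rk (N + i) + i <= rk N.
  elim: i => [|i IH]; first by rewrite !addn0.
  by apply: leq_trans IH; rewrite addnS addnS -addSn leq_add2r rk_dec ?leq_addr.
by have := rk_bound (rk N).+1; rewrite addnS ltnNge leq_addl.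
Qed.

Hypothesis sem_det : semantically_deterministic A.

(** Prefixing the word with [a] yields acceptance from some successor of [s]; semantic determinism
    moves it to [s']. *)
Lemma lang_incl_step q s a q' s' : lang_incl q s ->
  q' \in delta A q a -> s' \in delta A s a -> lang_incl q' s'.
Proof.
move=> qs qq' ss' w wq'.
have /qs/lang_step[s'' /= ss'' ws''] : lang (with_init A q) (wcons a w).
  by apply/lang_step; exists q'.
exact/(sem_det ss'' ss').
Qed.

(** For completeness, an accepting run from [q] is followed up to its safe suffix, where the pair
    lies in the core; backward reachability recovers the prefix. *)
Lemma non_inclP q s : reflect (~ lang_incl q s) ((q, s) \in non_incl).
Proof.
apply: (iffP idP).
  rewrite /non_incl; elim: {1}m q s => [|i IH] q s /=; first by rewrite inE.
  rewrite inE => /orP[/spoil_core_sound[w [wq ws]] /(_ _ (lang_safe_sub wq))//|].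
  case/existsP=> a /exists_inP[q' qq' /exists_inP[s' ss' /IH H]] qs; apply: H.
  exact: lang_incl_step qs qq' ss'.
move=> qsN; have [w [wq ws]] : exists w,
    lang (with_init A q) w /\ ~ lang (with_init A s) w.
  apply: NNPP => H; apply: qsN => w wq; apply: NNPP => ws; apply: H.
  by exists w.
case: wq => r [[/= <- rd] racc] {qsN}.
have [i Hi] := accepting_safe_suffix rd racc.
elim: i r s w rd {racc}ws Hi => [|i IH] r s w rd ws Hi.
  by rewrite -non_inclE inE (spoil_core_complete Hi ws).
(* Any successor of [s] will do, since the rest of the word is rejected from each of them. *)
have /set0Pn[s' ss'] := delta_total A s (w 0).
rewrite -non_inclE inE; apply/orP; right; apply/existsP; exists (w 0).
apply/exists_inP; exists (r 1) => //; apply/exists_inP; exists s' => //.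
apply: (IH (fun i => r i.+1) _ (tl w)) => [j||]; first exact: rd.
  by move=> ws'; apply: ws; apply/lang_step; exists s'.
by rewrite -iterSr.
Qed.

Definition strong_equivb q s : bool :=
  [&& (q, s) \notin spoil_once setT, (s, q) \notin spoil_once setT,
      (q, s) \notin non_incl & (s, q) \notin non_incl].

Lemma lang_safe_inclP q s :
  reflect (lang_safe_incl q s) ((q, s) \notin spoil_once setT).
Proof.
apply: (iffP idP) => [H w wq|H].
  by apply: NNPP => ws; case/spoil_onceTP: H; exists w.
by apply/spoil_onceTP => -[w [/H]].
Qed.

Lemma strong_equivbP q s : reflect (strong_equiv A q s) (strong_equivb q s).
Proof.
apply: (iffP and4P) => [[/lang_safe_inclP H1 /lang_safe_inclP H2]|[H1 H2]].
  move=> /non_inclP/NNPP H3 /non_inclP/NNPP H4.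
  by split=> w; split; [apply: H3 | apply: H4 | apply: H1 | apply: H2].
split.
1,2: by apply/lang_safe_inclP => w /H2.
all: by apply/non_inclP => H; apply: H => w /H1.
Qed.

End Inclusion.

(** * The quotient automaton *)

Section Quotient.
Variables (Sigma Q : finType) (A : tNCW Sigma Q) (e : rel Q).
Hypothesis eP : forall q s, reflect (strong_equiv A q s) (e q s).
Implicit Types (q s x y : Q) (a : Sigma) (w : nat -> Sigma).

Lemma e_refl : reflexive e.
Proof. by move=> q; apply/eP; split. Qed.

Lemma e_sym : symmetric e.
Proof.
by move=> q s; apply/eP/eP => -[H1 H2]; split=> w; rewrite ?H1 ?H2.
Qed.

Lemma e_trans : transitive e.
Proof.
move=> s q x /eP[H1 H2] /eP[H3 H4]; apply/eP.
by split=> w; rewrite ?H1 ?H2.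
Qed.

(** Choosing the least member in the order of [enum] lets a program recognise representatives by
    comparing numbers. *)
Definition is_repr x := [forall y, e y x ==> (enum_rank x <= enum_rank y)].

Definition min_repr x : Q := [arg min_(y < x | e y x) enum_rank y].

Lemma min_repr_e x : e (min_repr x) x.
Proof. by rewrite /min_repr; case: arg_minnP => //; apply: e_refl. Qed.

Lemma is_repr_min_repr x : is_repr (min_repr x).
Proof.
apply/forallP => y; apply/implyP; rewrite /min_repr.
case: arg_minnP => [|z zx H yz]; first exact: e_refl.
exact/H/(e_trans yz).
Qed.

(** A subtype of [Q] is enumerated in the order of [Q], which settles how the states of the quotient
    are numbered in its encoding. *)
Definition quot := {x : Q | is_repr x}.

Definition cls x : quot := Sub (min_repr x) (is_repr_min_repr x).

Lemma cls_e x : e (val (cls x)) x.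
Proof. by rewrite SubK min_repr_e. Qed.

Lemma e_val_inj (p t : quot) : e (val p) (val t) -> p = t.
Proof.
move=> ept; apply/val_inj/enum_rank_inj/val_inj/eqP; rewrite eqn_leq.
have etp : e (val t) (val p) by rewrite e_sym.
have /forallP/(_ (val t))/implyP/(_ etp) -> := valP p.
by have /forallP/(_ (val p))/implyP/(_ ept) -> := valP t.
Qed.

Lemma cls_eq x (p : quot) : e x (val p) -> cls x = p.
Proof. by move=> xp; apply/e_val_inj/(e_trans (cls_e x)). Qed.

Definition quot_delta (p : quot) a : {set quot} :=
  [set t : quot | [exists x, [exists s,
     [&& e x (val p), e s (val t) & s \in delta A x a]]]].

Definition quot_alpha : {set quot * Sigma * quot} :=
  [set pat : quot * Sigma * quot | [exists x, [exists s,
     [&& e x (val pat.1.1), e s (val pat.2) & (x, pat.1.2, s) \in alpha A]]]].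

Lemma quot_deltaP p a (t : quot) : reflect
  (exists x s, [/\ e x (val p), e s (val t) & s \in delta A x a])
  (t \in quot_delta p a).
Proof.
rewrite inE; apply: (iffP existsP) => [[x /existsP[s /and3P[]]]|[x [s []]]].
  by exists x, s.
by exists x; apply/existsP; exists s; apply/and3P.
Qed.

Lemma quot_alphaP p a t : reflect
  (exists x s, [/\ e x (val p), e s (val t) & (x, a, s) \in alpha A])
  ((p, a, t) \in quot_alpha).
Proof.
rewrite inE; apply: (iffP existsP) => [[x /existsP[s /and3P[]]]|[x [s []]]].
  by exists x, s.
by exists x; apply/existsP; exists s; apply/and3P.
Qed.

Lemma mem_quot_delta x a s : s \in delta A x a -> cls s \in quot_delta (cls x) a.
Proof.
by move=> xs; apply/quot_deltaP; exists x, s; split=> //; rewrite e_sym cls_e.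
Qed.

Lemma quot_delta_total p a : quot_delta p a != set0.
Proof.
have /set0Pn[s ss] := delta_total A (val p) a.
apply/set0Pn; exists (cls s); apply/quot_deltaP; exists (val p), s.
by split=> //; rewrite ?e_refl // e_sym cls_e.
Qed.

Lemma quot_alpha_sub p a t : (p, a, t) \in quot_alpha -> t \in quot_delta p a.
Proof.
move=> /quot_alphaP[x [s [xp st al]]]; apply/quot_deltaP.
by exists x, s; split=> //; apply: alpha_sub al.
Qed.

Definition quotient : tNCW Sigma quot :=
  TNCW (cls (init A)) quot_delta_total quot_alpha_sub.

Hypothesis niceA : nice A.
Hypothesis homA : alpha_homogenous A.

Let reachA : forall q, reachable A q. Proof. by case: niceA. Qed.
Let gfgA : forall q, GFG (with_init A q). Proof. by case: niceA. Qed.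
Let normA : normal A. Proof. by case: niceA. Qed.
Let sdetA : safe_deterministic A. Proof. by case: niceA. Qed.
Let detA : semantically_deterministic A. Proof. by case: niceA. Qed.

(** The letter [a] followed by a safe word from [s] is safe from [x], hence from [y], which yields
    [s']. By safe determinism the safe language of [x] determines that of its [a]-successor, and
    likewise for [y]. *)
Lemma e_delta_safe x y a s : e x y -> s \in delta_safe A x a ->
  exists2 s', s' \in delta_safe A y a & e s s'.
Proof.
move=> /eP[Hl Hs] xs.
have [w ws] := lang_safe_inhab sdetA normA xs.
have /Hs/lang_safe_step[s' /= ys' _] : lang_safe (with_init A x) (wcons a w).
  by apply/lang_safe_step; exists s.
exists s' => //; apply/eP; split.
  move=> v; split.
    exact: (lang_incl_step detA (fun w => (Hl w).1) (delta_safe_sub xs) (delta_safe_sub ys')).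
  exact: (lang_incl_step detA (fun w => (Hl w).2) (delta_safe_sub ys') (delta_safe_sub xs)).
have step z z' r r' : (forall w, lang_safe (with_init A z) w -> lang_safe (with_init A z') w) ->
    r \in delta_safe A z a -> r' \in delta_safe A z' a ->
    forall v, lang_safe (with_init A r) v -> lang_safe (with_init A r') v.
  move=> H zr zr' v rv.
  have /H/lang_safe_step[r'' /= zr''] : lang_safe (with_init A z) (wcons a v).
    by apply/lang_safe_step; exists r.
  by rewrite (delta_safe_uniq sdetA zr' zr'').
by move=> v; split; [apply: (step _ _ _ _ _ xs ys') | apply: (step _ _ _ _ _ ys' xs)] => u /Hs.
Qed.

(** Homogeneity extends from states to classes, because [y] inherits a safe [a]-successor from
    [x]. *)
Lemma e_no_mix x y a s s' : e x y -> s \in delta_safe A x a ->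
  (y, a, s') \in alpha A -> False.
Proof.
move=> xy /(e_delta_safe xy)[r ry _]; rewrite -in_delta_alpha => ys'.
by case: (homA y a) => H; [rewrite H inE in ys' | rewrite H inE in ry].
Qed.

(** By definition one alpha-transition between members spoils a transition of the quotient;
    [e_no_mix] excludes this as soon as one member has a safe one. *)
Lemma quot_safeP p a t : reflect
  (exists x s, [/\ e x (val p), e s (val t) & s \in delta_safe A x a])
  (t \in delta_safe quotient p a).
Proof.
rewrite in_delta_safe; apply: (iffP andP).
  move=> [/quot_deltaP[x [s [xp st xs]]] /quot_alphaP al].
  exists x, s; split=> //; rewrite in_delta_safe xs.
  by apply/negP => H; apply: al; exists x, s.
move=> [x [s [xp st xs]]]; split.
  by apply/quot_deltaP; exists x, s; split=> //; apply: delta_safe_sub.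
apply/quot_alphaP => -[y [s' [yp _ al]]].
by apply: (e_no_mix _ xs al); apply: e_trans xp _; rewrite e_sym.
Qed.

Lemma quot_safe_step p a t : t \in delta_safe quotient p a ->
  exists2 s, s \in delta_safe A (val p) a & e s (val t).
Proof.
move=> /quot_safeP[x [s [xp st /(e_delta_safe xp)[s' ps' ss']]]].
by exists s' => //; apply: e_trans st; rewrite e_sym.
Qed.

Lemma mem_quot_safe x a s :
  s \in delta_safe A x a -> cls s \in delta_safe quotient (cls x) a.
Proof.
by move=> xs; apply/quot_safeP; exists x, s; rewrite ![e _ (val _)]e_sym !cls_e.
Qed.

Lemma quot_safe_det : safe_deterministic quotient.
Proof.
move=> p a; apply/card_le1_eqP => t t' /quot_safe_step[s ps st].
move=> /quot_safe_step[s' ps' st']; apply/esym/e_val_inj; apply: e_trans st'.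
by rewrite e_sym (delta_safe_uniq sdetA ps' ps).
Qed.

(** Both inclusions are coinductive: safe transitions lift to every member of a class and project to
    classes. *)
Lemma quot_lang_safe x w :
  lang_safe (with_init quotient (cls x)) w <-> lang_safe (with_init A x) w.
Proof.
split=> H.
  pose P y v := lang_safe (with_init quotient (cls y)) v.
  apply: (lang_safe_coind sdetA (P := P)) H => y v /lang_safe_step[t].
  move=> /quot_safe_step[s ys st] tv.
  have [s' ys' ss'] := e_delta_safe (cls_e y) ys.
  exists s' => //; rewrite /P (cls_eq (p := t)) //.
  by apply: e_trans st; rewrite e_sym.
pose P (p : quot) v := lang_safe (with_init A (val p)) v.
apply: (lang_safe_coind quot_safe_det (P := P)).
  move=> p v /lang_safe_step[s ps sv]; exists (cls s).
    by rewrite -(cls_eq (e_refl (val p))) mem_quot_safe.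
  by have /eP[_ es] := cls_e s; apply/es.
by have /eP[_ ex] := cls_e x; apply/ex.
Qed.

Lemma e_delta x y a s s' : e x y -> s \in delta A x a -> s' \in delta A y a ->
  lang_equiv A s s'.
Proof.
move=> /eP[H _] xs ys' w; split.
  exact: (lang_incl_step detA (fun w => (H w).1) xs ys').
exact: (lang_incl_step detA (fun w => (H w).2) ys' xs).
Qed.

(** Projection creates no new alpha-transitions, since safe transitions stay safe in the
    quotient. *)
Lemma quot_accepting x (f : seq Sigma -> Q) w :
  (forall u a, f (rcons u a) \in delta A (f u) a) ->
  accepting (with_init A x) w (fun i => f (mkseq w i)) ->
  accepting (with_init quotient (cls x)) w (fun i => cls (f (mkseq w i))).
Proof.
move=> fd [N HN]; exists N => i /HN nal.
have : f (mkseq w i.+1) \in delta_safe A (f (mkseq w i)) (w i).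
  by rewrite in_delta_safe nal andbT mkseqS fd.
by move=> /mem_quot_safe; rewrite in_delta_safe => /andP[].
Qed.

(** A run of the quotient may change members at each step, so it does not lift as a whole. Its safe
    suffix is transferred by [quot_lang_safe], its prefix by equality of languages. The converse
    projects the run of a GFG strategy. *)
Lemma quot_lang x w :
  lang (with_init quotient (cls x)) w <-> lang (with_init A x) w.
Proof.
split.
  move=> [r [[/= r0 rd] acc]]; have [i] := accepting_safe_suffix (A := quotient) rd acc.
  move=> Hi; have {Hi acc} : lang (with_init A (val (r i))) (iter i tl w).
    by apply/lang_safe_sub/quot_lang_safe; rewrite (cls_eq (e_refl _)).
  have <- : lang (with_init A (val (r 0))) w <-> lang (with_init A x) w.
    by rewrite r0; have /eP[-> _] := cls_e x.
  (* Acceptance travels back along the run: successors of equivalent states under one letter have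
     equal languages, so a successor of the representative replaces the one taken. *)
  elim: i => // i IH Hi; apply: IH; apply/lang_step; rewrite iter_tlE.
  have /quot_deltaP[y [s [yp st ys]]] := rd i.
  have /set0Pn[s' ps'] := delta_total A (val (r i)) (w i).
  exists s' => //; apply/(e_delta yp ys ps').
  by have /eP[-> _] := st.
move=> wx; have [f [/= f0 fd /(_ _ wx)/quot_accepting acc]] := gfgA x.
exists (fun i => cls (f (mkseq w i))); split; last exact: acc.
split=> [|i] /=; first by rewrite f0.
by rewrite mkseqS; apply: mem_quot_delta.
Qed.

Lemma val_quot_lang (p : quot) w :
  lang (with_init quotient p) w <-> lang (with_init A (val p)) w.
Proof. by rewrite -[in X in X <-> _](cls_eq (e_refl (val p))); apply: quot_lang. Qed.

Lemma val_quot_lang_safe (p : quot) w :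
  lang_safe (with_init quotient p) w <-> lang_safe (with_init A (val p)) w.
Proof.
by rewrite -[in X in X <-> _](cls_eq (e_refl (val p))); apply: quot_lang_safe.
Qed.

Lemma quot_GFG p : GFG (with_init quotient p).
Proof.
have [f [/= f0 fd fa]] := gfgA (val p).
exists (cls \o f); split=> [|u a|w] /=.
- by rewrite f0 (cls_eq (e_refl _)).
- exact: mem_quot_delta.
- by move=> /val_quot_lang/fa/(quot_accepting fd).
Qed.

Lemma connect_quot x y :
  connect (safe_edge A) x y -> connect (safe_edge quotient) (cls x) (cls y).
Proof.
move=> /connectP[p]; elim: p x => [|z p IH] x /= => [_ -> //|/andP[xz pz] yl].
apply: connect_trans (IH _ pz yl); apply: connect1.
by have /existsP[a xza] := xz; apply/existsP; exists a; apply: mem_quot_safe.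
Qed.

Lemma quot_reachable p : reachable quotient p.
Proof.
have /connectP[l] := reachA (val p); rewrite /reachable -[init quotient]/(cls (init A)).
elim: l (init A) => [|z l IH] x /= => [_ <-|/andP[xz pz] yl].
  by rewrite (cls_eq (e_refl _)).
apply: connect_trans (IH _ pz yl); apply: connect1.
by have /existsP[a xza] := xz; apply/existsP; exists a; apply: mem_quot_delta.
Qed.

(** Each safe edge of the quotient lifts to one that leaves the representative; normality of [A]
    gives a way back, which projects. *)
Lemma quot_normal : normal quotient.
Proof.
move=> p t /connectP[l]; elim: l p => [|z l IH] p /= => [_ -> //|/andP[pz pl] yl].
apply: connect_trans (IH _ pl yl) _.
have /existsP[a /quot_safe_step[s ps sz]] := pz.
rewrite -(cls_eq sz) -(cls_eq (e_refl (val p))); apply/connect_quot/normA/connect1.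
by apply/existsP; exists a.
Qed.

Lemma quot_sem_det : semantically_deterministic quotient.
Proof.
move=> p a t t' /quot_deltaP[x [s [xp st xs]]] /quot_deltaP[x' [s' [xp' st' xs']]] w.
rewrite !val_quot_lang; have /eP[<- _] := st; have /eP[<- _] := st'.
by apply: (e_delta _ xs xs'); apply: e_trans xp _; rewrite e_sym.
Qed.

Lemma quot_nice : nice quotient.
Proof.
split; [exact: quot_reachable | exact: quot_GFG | exact: quot_normal |
        exact: quot_safe_det | exact: quot_sem_det].
Qed.

Lemma quot_safe_centralized : safe_centralized A -> safe_centralized quotient.
Proof.
move=> cen p t [Hl Hs]; rewrite -(cls_eq (e_refl (val p))) -(cls_eq (e_refl (val t))).
have /cen/andP[pt tp] : subsafe_equiv A (val p) (val t).
  by split=> w; [rewrite -!val_quot_lang | rewrite -!val_quot_lang_safe; apply: Hs].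
by apply/andP; split; apply: connect_quot.
Qed.

Lemma quot_safe_minimal : safe_minimal quotient.
Proof.
move=> p t /eqP pt [Hl Hs]; apply: pt; apply/e_val_inj/eP.
by split=> w; rewrite -?val_quot_lang -?val_quot_lang_safe.
Qed.

Lemma quot_homogenous : alpha_homogenous quotient.
Proof.
move=> p a; have [->|[t pt]] := set_0Vmem (delta_alpha quotient p a); [by left|right].
apply/setP => t'; rewrite [RHS]inE; apply/negP => /quot_safe_step[s ps st].
move: pt; rewrite in_delta_alpha => /quot_alphaP[x [s' [xp _ al]]].
by apply: e_no_mix ps al; rewrite e_sym.
Qed.

End Quotient.

(** * Compilation of bounded loops to the random access machine *)

(** Registers are split modulo 4 into program constants, temporaries, heap cells
    and loop variables, so that no bound on any of the four is needed. *)
Definition preg p := 4 * p.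
Definition treg t := 4 * t + 1.
Definition hreg a := 4 * a + 2.
Definition vreg i := 4 * i + 3.

(** [EVar] is a de Bruijn index bound by [ESum] and [CFor]; [ESum] ranges over
    the numbers below the constant [EPar 5], and [CFor p] below [EPar p]. *)
Inductive exp :=
| ECst (c : nat)
| EVar (i : nat)
| EPar (p : nat)
| EAdd (e1 e2 : exp)
| ESub (e1 e2 : exp)
| ESum (e : exp)
| EGet (e : exp).

Inductive cmd :=
| CPut (e1 e2 : exp)
| CRead (e : exp)
| CPrint (e : exp)
| CIf (e : exp) (c : cmd)
| CFor (p : nat) (c : cmd)
| CSeq (c1 c2 : cmd).

(** Turns the heap address in temporary [t] into the number of its register. *)
Definition caddr t : program :=
  [:: IAdd (treg t) (treg t) (treg t); IAdd (treg t) (treg t) (treg t);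
      IConst (treg t.+2) 2; IAdd (treg t) (treg t) (treg t.+2)].

Fixpoint cexp o d t e : program :=
  match e with
  | ECst c => [:: IConst (treg t) c]
  | EVar i => [:: if i < d then IAdd (treg t) (vreg (d - i.+1)) (preg 0)
                 else IConst (treg t) 0]
  | EPar p => [:: IAdd (treg t) (preg p) (preg 0)]
  | EAdd e1 e2 =>
    let c1 := cexp o d t e1 in let c2 := cexp (o + size c1) d t.+1 e2 in
    c1 ++ c2 ++ [:: IAdd (treg t) (treg t) (treg t.+1)]
  | ESub e1 e2 =>
    let c1 := cexp o d t e1 in let c2 := cexp (o + size c1) d t.+1 e2 in
    c1 ++ c2 ++ [:: ISub (treg t) (treg t) (treg t.+1)]
  | ESum e =>
    let c := cexp (o + 3) d.+1 t.+1 e in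
    [:: IConst (treg t) 0; IConst (vreg d) 0; IJump (preg 1) (o + 3 + size c + 2)]
    ++ c ++
    [:: IAdd (treg t) (treg t) (treg t.+1); IAdd (vreg d) (vreg d) (preg 1);
        ISub (treg t.+1) (preg 5) (vreg d); IJump (treg t.+1) (o + 3)]
  | EGet e => cexp o d t e ++ caddr t ++ [:: ILoad (treg t) (treg t)]
  end.

(** In [CPut] the value waits in temporary 1 while [caddr 0] works on temporaries 0 and 2. *)
Fixpoint ccmd o d c : program :=
  match c with
  | CPut e1 e2 =>
    let c1 := cexp o d 0 e1 in let c2 := cexp (o + size c1) d 1 e2 in
    c1 ++ c2 ++ caddr 0 ++ [:: IStore (treg 0) (treg 1)]
  | CRead e => cexp o d 0 e ++ caddr 0 ++ [:: IRead (treg 1); IStore (treg 0) (treg 1)]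
  | CPrint e => cexp o d 0 e ++ [:: IPrint (treg 0)]
  | CIf e c =>
    let ce := cexp o d 0 e in let o' := o + size ce + 2 in let cc := ccmd o' d c in
    ce ++ [:: ISub (treg 0) (preg 1) (treg 0); IJump (treg 0) (o' + size cc)] ++ cc
  | CFor p c =>
    let cc := ccmd (o + 2) d.+1 c in
    [:: IConst (vreg d) 0; IJump (preg 1) (o + 2 + size cc + 1)] ++ cc ++
    [:: IAdd (vreg d) (vreg d) (preg 1); ISub (treg 0) (preg p) (vreg d);
        IJump (treg 0) (o + 2)]
  | CSeq c1 c2 =>
    let cc := ccmd o d c1 in cc ++ ccmd (o + size cc) d c2
  end.

(** * Denotations, step counts and memory layout *)

Section Semantics.
Variable par : nat -> nat.
Local Notation M := (par 5).

Fixpoint eval (rho : seq nat) (h : nat -> nat) e : nat :=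
  match e with
  | ECst c => c
  | EVar i => nth 0 rho i
  | EPar p => par p
  | EAdd e1 e2 => eval rho h e1 + eval rho h e2
  | ESub e1 e2 => eval rho h e1 - eval rho h e2
  | ESum e => \sum_(0 <= x < M) eval (x :: rho) h e
  | EGet e => h (eval rho h e)
  end.

Record store := Store { heap : nat -> nat; inp : seq nat; out : seq nat }.

Fixpoint den (rho : seq nat) c st : store :=
  match c with
  | CPut e1 e2 =>
    let h := heap st in Store (upd h (eval rho h e1) (eval rho h e2)) (inp st) (out st)
  | CRead e =>
    let h := heap st in
    Store (upd h (eval rho h e) (head 0 (inp st))) (behead (inp st)) (out st)
  | CPrint e => Store (heap st) (inp st) (rcons (out st) (eval rho (heap st) e))
  | CIf e c => if 0 < eval rho (heap st) e then den rho c st else st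
  | CFor p c => foldl (fun st x => den (x :: rho) c st) st (iota 0 (par p))
  | CSeq c1 c2 => den rho c2 (den rho c1 st)
  end.

(** Each loop is charged [m] rounds whatever its own bound, which makes the cost a polynomial in
    [m]. *)
Fixpoint ecost m e :=
  match e with
  | ECst _ | EVar _ | EPar _ => 1
  | EAdd e1 e2 | ESub e1 e2 => ecost m e1 + ecost m e2 + 1
  | ESum e => 5 + m * (ecost m e + 4)
  | EGet e => ecost m e + 5
  end.

Fixpoint ccost m c :=
  match c with
  | CPut e1 e2 => ecost m e1 + ecost m e2 + 5
  | CRead e => ecost m e + 6
  | CPrint e => ecost m e + 1
  | CIf e c => ecost m e + 2 + ccost m c
  | CFor _ c => 4 + m * (ccost m c + 3)
  | CSeq c1 c2 => ccost m c1 + ccost m c2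
  end.

Definition code_at (P : program) o cs :=
  exists pre post, P = pre ++ cs ++ post /\ size pre = o.

Lemma code_at_cat P o cs cs' :
  code_at P o (cs ++ cs') -> code_at P o cs /\ code_at P (o + size cs) cs'.
Proof.
move=> [pre [post [-> <-]]]; split.
  by exists pre, (cs' ++ post); rewrite -catA.
by exists (pre ++ cs), post; rewrite size_cat -!catA.
Qed.

Lemma code_at_cons P o i cs :
  code_at P o (i :: cs) -> onth P o = Some i /\ code_at P o.+1 cs.
Proof.
move=> /(@code_at_cat _ _ [:: i])[[pre [post [-> <-]]]]; rewrite addn1; split=> //.
by rewrite onth_cat ltnn subnn.
Qed.

Definition reach P N c c' := exists2 n, n <= N & iter n (step P) c = c'.

Lemma reach_refl P N c : reach P N c c.
Proof. by exists 0. Qed.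

Lemma reach_pc P N o o' X x y : o = o' ->
  reach P N (Config o X x y) (Config o' X x y).
Proof. by move=> ->; apply: reach_refl. Qed.

Lemma reach_trans P N1 N2 c1 c2 c3 :
  reach P N1 c1 c2 -> reach P N2 c2 c3 -> reach P (N1 + N2) c1 c3.
Proof.
move=> [n1 le1 <-] [n2 le2 <-]; exists (n1 + n2); first exact: leq_add.
by rewrite addnC iterD.
Qed.

Lemma reach_le P N N' c c' : reach P N c c' -> N <= N' -> reach P N' c c'.
Proof. by move=> [n le <-] le'; exists n => //; apply: leq_trans le'. Qed.

Lemma reach_step P N o i X x y c' : onth P o = Some i ->
  reach P N (exec i (Config o X x y)) c' -> reach P N.+1 (Config o X x y) c'.
Proof. by move=> Pi [n le <-]; exists n.+1 => //; rewrite iterSr /step /= Pi. Qed.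

(** Temporaries and the variables of levels from [size rho] on are left unconstrained, hence free
    for use. *)
Definition rep rho h X :=
  [/\ forall p, X (preg p) = par p,
      forall i, i < size rho -> X (vreg (size rho - i.+1)) = nth 0 rho i
    & forall a, X (hreg a) = h a].

Lemma upd_same X i v : upd X i v i = v.
Proof. by rewrite /upd eqxx. Qed.

Lemma upd_other X i v j : j <> i -> upd X i v j = X j.
Proof. by rewrite /upd => /eqP/negbTE->. Qed.

End Semantics.

Ltac regs := unfold preg, treg, hreg, vreg in *; lia.
Ltac updE := repeat (rewrite upd_same || (rewrite upd_other; last by regs)).

(** * Correctness of the compiled code *)

Section Correct.
Variable par : nat -> nat.
Local Notation M := (par 5).
Hypothesis par0 : par 0 = 0.
Hypothesis par1 : par 1 = 1.
Hypothesis par_le : forall p, par p <= M.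

Lemma rep_treg rho h X t v : rep par rho h X -> rep par rho h (upd X (treg t) v).
Proof. by case=> H1 H2 H3; split=> *; updE; auto. Qed.

Lemma rep_push rho h X x : rep par rho h X -> X (vreg (size rho)) = x ->
  rep par (x :: rho) h X.
Proof.
case=> H1 H2 H3 H4; split=> // -[|i] /= lei; first by rewrite subSS subn0.
by rewrite subSS H2.
Qed.

Lemma rep_pop rho h X x : rep par (x :: rho) h X ->
  rep par rho h X /\ X (vreg (size rho)) = x.
Proof.
case=> H1 H2 H3; split; last by have := H2 0 isT; rewrite /= subSS subn0.
by split=> // i lei; have := H2 i.+1 lei; rewrite /= subSS.
Qed.

Lemma caddr_ok P o t X x y : code_at P o (caddr t) -> exists X',
  [/\ reach P 4 (Config o X x y) (Config (o + 4) X' x y),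
      X' (treg t) = hreg (X (treg t))
    & forall j, j <> treg t -> j <> treg t.+2 -> X' j = X j].
Proof.
move=> /code_at_cons[P0 /code_at_cons[P1 /code_at_cons[P2 /code_at_cons[P3 _]]]].
eexists; split.
- apply: reach_step P0 _ => /=; apply: reach_step P1 _ => /=.
  apply: reach_step P2 _ => /=; apply: reach_step P3 _ => /=.
  by rewrite addn4; apply: reach_refl.
- updE. rewrite /hreg; lia.
- by move=> j H1 H2; rewrite !upd_other.
Qed.


(** The last clause keeps the value of a left operand, or a partial sum, alive while later code runs
    on higher temporaries. *)
Lemma cexp_ok e : forall P o rho t h X x y,
  code_at P o (cexp o (size rho) t e) -> rep par rho h X ->
  exists X', [/\ reach P (ecost M e) (Config o X x y)
                   (Config (o + size (cexp o (size rho) t e)) X' x y),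
                 rep par rho h X', X' (treg t) = eval par rho h e
               & forall t', t' < t -> X' (treg t') = X (treg t')].
Proof.
elim: e => [c|i|p|e1 IH1 e2 IH2|e1 IH1 e2 IH2|e IH|e IH] P o rho t h X x y /=.
- move=> /code_at_cons[P0 _] XR; eexists; split.
  + by apply: reach_step P0 _ => /=; rewrite addn1; apply: reach_refl.
  + exact: rep_treg.
  + by updE.
  + by move=> t' lt; updE.
- move=> /code_at_cons[P0 _] XR; have [X0 Xi _] := XR.
  case: ltnP P0 => lei P0; eexists; split;
    try (by apply: reach_step P0 _ => /=; rewrite addn1; apply: reach_refl);
    try exact: rep_treg; try (by move=> t' lt; updE); updE.
    by rewrite X0 par0 addn0 Xi.
  by rewrite nth_default.
- move=> /code_at_cons[P0 _] XR; have [X0 Xi _] := XR; eexists; split.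
  + by apply: reach_step P0 _ => /=; rewrite addn1; apply: reach_refl.
  + exact: rep_treg.
  + by updE; rewrite !X0 par0 addn0.
  + by move=> t' lt; updE.
- move=> /code_at_cat[Pa /code_at_cat[Pb /code_at_cons[Pc _]]] XR.
  have [X1 [R1 XR1 E1 K1]] := IH1 _ _ _ _ _ _ x y Pa XR.
  have [X2 [R2 XR2 E2 K2]] := IH2 _ _ _ _ _ _ x y Pb XR1.
  eexists; split.
  + apply: reach_trans (reach_trans R1 R2) _; apply: reach_step Pc _ => /=.
    by rewrite !size_cat /= !addnA addn1; apply: reach_refl.
  + exact: rep_treg.
  + by updE; rewrite E2 K2 // E1.
  + by move=> t' lt; updE; rewrite K2 ?K1 //; lia.
- move=> /code_at_cat[Pa /code_at_cat[Pb /code_at_cons[Pc _]]] XR.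
  have [X1 [R1 XR1 E1 K1]] := IH1 _ _ _ _ _ _ x y Pa XR.
  have [X2 [R2 XR2 E2 K2]] := IH2 _ _ _ _ _ _ x y Pb XR1.
  eexists; split.
  + apply: reach_trans (reach_trans R1 R2) _; apply: reach_step Pc _ => /=.
    by rewrite !size_cat /= !addnA addn1; apply: reach_refl.
  + exact: rep_treg.
  + by updE; rewrite E2 K2 // E1.
  + by move=> t' lt; updE; rewrite K2 ?K1 //; lia.
- set c := cexp _ _ _ _.
  move=> /code_at_cons[P0 /code_at_cons[P1 /code_at_cons[P2]]] /=.
  rewrite -[o.+3]addn3 => /code_at_cat[Pb].
  move=> /code_at_cons[Q0 /code_at_cons[Q1 /code_at_cons[Q2 /code_at_cons[Q3 _]]]] XR.
  (* Invariant at the loop test, with [j] rounds left and partial sum [s]. Besides the body, a round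
     takes 2 steps for the test and 2 for the updates; the final failing test takes 2. *)
  have loop j : forall i s X, i + j = M -> rep par rho h X ->
      X (vreg (size rho)) = i -> X (treg t) = s -> exists X',
    [/\ reach P (2 + j * (ecost M e + 4))
          (Config (o + 3 + size c + 2) X x y) (Config (o + 3 + size c + 4) X' x y),
        rep par rho h X', X' (treg t) = s + \sum_(i <= z < M) eval par (z :: rho) h e
      & forall t', t' < t -> X' (treg t') = X (treg t')].
    elim: j => [|j IHj] i s {XR}X ij XR Xi Xs; have [X0 _ _] := XR.
      eexists; split.
      - rewrite addn2; apply: reach_step Q2 _ => /=; apply: reach_step Q3 _ => /=.
        by updE; rewrite X0 Xi -ij addn0 subnn /=; apply: reach_pc; lia.
      - exact: rep_treg.
      - by updE; rewrite Xs big_geq ?addn0 // -ij addn0.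
      - by move=> t' lt; updE.
    have XR' := rep_push (rep_treg t.+1 (M - i) XR) (x := i).
    have {}XR' := XR' ltac:(by updE).
    have [X1 [R1 XR1 E1 K1]] := IH P (o + 3) (i :: rho) t.+1 h _ x y Pb XR'.
    have [{}XR1 V1] := rep_pop XR1.
    pose X2 := upd (upd X1 (treg t) (X1 (treg t) + X1 (treg t.+1)))
                 (vreg (size rho)) i.+1.
    have XR2 : rep par rho h X2.
      have [Y0 Yi Yh] := XR1.
      by split=> [p|k ltk|a]; rewrite /X2; updE; auto.
    have [X3 [R3 XR3 E3 K3]] := IHj i.+1 (s + eval par (i :: rho) h e) X2
      ltac:(lia) XR2 ltac:(by rewrite /X2; updE)
      ltac:(by rewrite /X2; updE; rewrite E1 K1 //; updE; rewrite Xs).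
    exists X3; split=> //.
    - apply: (@reach_le _ (2 + (ecost M e + 2 + (2 + j * (ecost M e + 4)))));
        last by rewrite mulSn; lia.
      apply: (@reach_trans _ _ _ _ (Config (o + 3) (upd X (treg t.+1) (M - i)) x y)).
        rewrite addn2; apply: reach_step Q2 _ => /=; apply: reach_step Q3 _ => /=.
        updE; rewrite X0 Xi; have -> : 0 < M - i by lia.
        exact: reach_refl.
      apply: reach_trans R3; apply: reach_trans R1 _.
      apply: reach_step Q0 _ => /=; apply: reach_step Q1 _ => /=.
      have [Y0 _ _] := XR1.
      updE; rewrite V1 Y0 par1 addn1; apply: reach_pc; lia.
    - by rewrite E3 [in RHS]big_ltn ?addnA //; lia.
    - by move=> t' lt; rewrite K3 // /X2; updE; rewrite K1; [updE|lia].
  have [X0 _ _] := XR.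
  pose X1 := upd (upd X (treg t) 0) (vreg (size rho)) 0.
  have XR1 : rep par rho h X1.
    have [Y0 Yi Yh] := XR.
    by split=> [p|k ltk|a]; rewrite /X1; updE; auto.
  have [X2 [R2 XR2 E2 K2]] := loop M 0 0 X1 (add0n _) XR1
    ltac:(by rewrite /X1; updE) ltac:(by rewrite /X1; updE).
  exists X2; split=> //.
  + rewrite -[5 + _]/(3 + (2 + _)); apply: reach_trans (_ : reach _ _ _ _) _.
      apply: reach_step P0 _ => /=; apply: reach_step P1 _ => /=.
      apply: reach_step P2 _ => /=; updE; rewrite X0 par1; apply: reach_refl.
    rewrite size_cat /=.
    by have -> : o + (size c + 4).+3 = o + 3 + size c + 4 by lia.
  + by move=> t' lt; rewrite K2 // /X1; updE.
- move=> /code_at_cat[Pa /(@code_at_cat _ _ (caddr t))[Pb /code_at_cons[Pc _]]] XR.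
  have [X1 [R1 XR1 E1 K1]] := IH _ _ _ _ _ _ x y Pa XR.
  have [X2 [R2 E2 K2]] := caddr_ok X1 x y Pb.
  have XR2 : rep par rho h X2.
    have [Y0 Yi Yh] := XR1.
    by split=> *; rewrite K2 ?Y0 ?Yi ?Yh //; regs.
  have [_ _ Yh] := XR2.
  eexists; split.
  + rewrite -[5]/(4 + 1) addnA; apply: reach_trans (reach_trans R1 R2) _.
    apply: reach_step Pc _ => /=.
    by apply: reach_pc; rewrite !size_cat /=; lia.
  + exact: rep_treg.
  + by updE; rewrite E2 E1 Yh.
  + by move=> t' lt; updE; rewrite K2 ?K1 //; regs.
Qed.


Lemma ccmd_ok c : forall P o rho X st, code_at P o (ccmd o (size rho) c) ->
  rep par rho (heap st) X ->
  exists X', reach P (ccost M c) (Config o X (inp st) (out st))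
      (Config (o + size (ccmd o (size rho) c)) X'
         (inp (den par rho c st)) (out (den par rho c st))) /\
    rep par rho (heap (den par rho c st)) X'.
Proof.
elim: c => [e1 e2|e|e|e c IH|p c IH|c1 IH1 c2 IH2] P o rho X [h x y] /=.
- move=> /code_at_cat[Pa /code_at_cat[Pb /(@code_at_cat _ _ (caddr 0))[Pc /code_at_cons[Pd _]]]] XR.
  have [X1 [R1 XR1 E1 K1]] := cexp_ok x y Pa XR.
  have [X2 [R2 XR2 E2 K2]] := cexp_ok x y Pb XR1.
  have [X3 [R3 E3 K3]] := caddr_ok X2 x y Pc.
  eexists; split.
    rewrite -[5]/(4 + 1) addnA; apply: reach_trans (reach_trans (reach_trans R1 R2) R3) _.
    apply: reach_step Pd _ => /=.
    by apply: reach_pc; rewrite !size_cat /=; lia.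
  have [Y0 Yi Yh] := XR2.
  have -> : X3 (treg 0) = hreg (eval par rho h e1) by rewrite E3 K2 // E1.
  have -> : X3 (treg 1) = eval par rho h e2 by rewrite K3 ?E2 //; regs.
  split=> [p|i lei|a]; [by updE; rewrite K3 ?Y0 //; regs | by updE; rewrite K3 ?Yi //; regs|].
  rewrite /upd; have [->|ne] := eqVneq a (eval par rho h e1); first by rewrite eqxx.
  case: eqP => [|_]; first by move: ne; regs.
  by rewrite K3 ?Yh //; regs.
- move=> /code_at_cat[Pa /(@code_at_cat _ _ (caddr 0))[Pc /code_at_cons[Pd /code_at_cons[Pe _]]]] XR.
  have [X1 [R1 XR1 E1 K1]] := cexp_ok x y Pa XR.
  have [X3 [R3 E3 K3]] := caddr_ok X1 x y Pc.
  eexists; split.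
    rewrite -[6]/(4 + 2) addnA; apply: reach_trans (reach_trans R1 R3) _.
    apply: reach_step Pd _ => /=; apply: reach_step Pe _ => /=.
    by apply: reach_pc; rewrite !size_cat /=; lia.
  have [Y0 Yi Yh] := XR1.
  updE; rewrite E3 E1.
  split=> [p|i lei|a]; [by updE; rewrite K3 ?Y0 //; regs | by updE; rewrite K3 ?Yi //; regs|].
  rewrite /upd; have [->|ne] := eqVneq a (eval par rho h e); first by rewrite eqxx.
  case: eqP => [|_]; first by move: ne; regs.
  case: eqP => [|_]; first by regs.
  by rewrite K3 ?Yh //; regs.
- move=> /code_at_cat[Pa /code_at_cons[Pd _]] XR.
  have [X1 [R1 XR1 E1 K1]] := cexp_ok x y Pa XR.
  exists X1; split=> //; apply: reach_trans R1 _.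
  apply: reach_step Pd _ => /=; rewrite E1.
  by apply: reach_pc; rewrite !size_cat /=; lia.
- set ce := cexp _ _ _ _; set cc := ccmd _ _ _.
  move=> /code_at_cat[Pa /code_at_cons[Pb /code_at_cons[Pc]]].
  rewrite -[_.+2]addn2 => Pd XR.
  have [X1 [R1 XR1 E1 K1]] := cexp_ok x y Pa XR.
  have [Y0 _ _] := XR1.
  case: ltnP => lt0.
    have [X2 [R2 XR2]] := IH P _ rho _ (Store h x y) Pd (rep_treg 0 (1 - X1 (treg 0)) XR1).
    exists X2; split=> //.
    rewrite size_cat /=; have -> : o + (size ce + (size cc).+2) = o + size ce + 2 + size cc by lia.
    apply: reach_trans R2; apply: reach_trans R1 _.
    apply: reach_step Pb _ => /=; apply: reach_step Pc _ => /=.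
    updE; rewrite Y0 par1 E1; have -> : 0 < 1 - eval par rho h e = false by lia.
    by apply: reach_pc; lia.
  eexists; split; last exact: (rep_treg 0 (1 - X1 (treg 0)) XR1).
  apply: (@reach_le _ (ecost M e + 2)); last by lia.
  apply: reach_trans R1 _.
  apply: reach_step Pb _ => /=; apply: reach_step Pc _ => /=.
  updE; rewrite Y0 par1 E1; have -> : 0 < 1 - eval par rho h e by lia.
  by apply: reach_pc; rewrite !size_cat /=; lia.
- set cc := ccmd _ _ _.
  move=> /code_at_cons[P0 /code_at_cons[P1]] /=.
  rewrite -[o.+2]addn2 => /code_at_cat[Pb].
  move=> /code_at_cons[Q0 /code_at_cons[Q1 /code_at_cons[Q2 _]]] XR.
  (* The same invariant; a round now has only the counter to update, hence the 3. *)
  have loop j : forall i st X, i + j = par p -> rep par rho (heap st) X ->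
      X (vreg (size rho)) = i ->
      let st' := foldl (fun st x => den par (x :: rho) c st) st (iota i j) in
      exists X', reach P (2 + j * (ccost M c + 3))
          (Config (o + 2 + size cc + 1) X (inp st) (out st))
          (Config (o + 2 + size cc + 3) X' (inp st') (out st')) /\
        rep par rho (heap st') X'.
    elim: j => [|j IHj] i st {XR}X ij XR Xi; have [X0 _ _] := XR.
      eexists; split; last exact: (rep_treg 0 (par p - i) XR).
      rewrite addn1; apply: reach_step Q1 _ => /=; apply: reach_step Q2 _ => /=.
      by updE; rewrite X0 Xi -ij addn0 subnn /=; apply: reach_pc; lia.
    have XR' := rep_push (rep_treg 0 (par p - i) XR) (x := i).
    have {}XR' := XR' ltac:(by updE).
    have [X1 [R1 XR1]] := IH P (o + 2) (i :: rho) _ st Pb XR'.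
    have [{}XR1 V1] := rep_pop XR1.
    pose X2 := upd X1 (vreg (size rho)) i.+1.
    have XR2 : rep par rho (heap (den par (i :: rho) c st)) X2.
      have [Y0 Yi Yh] := XR1.
      by split=> [q|k ltk|a]; rewrite /X2; updE; auto.
    have [X3 [R3 XR3]] := IHj i.+1 _ X2 ltac:(lia) XR2 ltac:(by rewrite /X2; updE).
    exists X3; split=> //.
    apply: (@reach_le _ (2 + (ccost M c + 1 + (2 + j * (ccost M c + 3)))));
      last by rewrite mulSn; lia.
    apply: (@reach_trans _ _ _ _ (Config (o + 2) (upd X (treg 0) (par p - i)) (inp st) (out st))).
      rewrite addn1; apply: reach_step Q1 _ => /=; apply: reach_step Q2 _ => /=.
      updE; rewrite X0 Xi; have -> : 0 < par p - i by lia.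
      exact: reach_refl.
    apply: reach_trans R3; apply: reach_trans R1 _.
    apply: reach_step Q0 _ => /=.
    have [Y0 _ _] := XR1.
    by updE; rewrite V1 Y0 par1 addn1; apply: reach_pc; lia.
  have [X0 _ _] := XR.
  pose X1 := upd X (vreg (size rho)) 0.
  have XR1 : rep par rho h X1.
    have [Y0 Yi Yh] := XR.
    by split=> [q|k ltk|a]; rewrite /X1; updE; auto.
  have [X2 [R2 XR2]] := loop (par p) 0 (Store h x y) X1 (add0n _) XR1
    ltac:(by rewrite /X1; updE).
  exists X2; split=> //.
  apply: (@reach_le _ (2 + (2 + par p * (ccost M c + 3)))); last first.
    by have := leq_mul (par_le p) (leqnn (ccost M c + 3)); lia.
  apply: reach_trans (_ : reach _ _ _ _) _.
    apply: reach_step P0 _ => /=; apply: reach_step P1 _ => /=.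
    updE; rewrite X0 par1; exact: reach_refl.
  rewrite size_cat /=.
  by have -> : o + (size cc + 3).+2 = o + 2 + size cc + 3 by lia.
- set cc := ccmd _ _ _ => /code_at_cat[Pa Pb] XR.
  have [X1 [R1 XR1]] := IH1 _ _ _ _ (Store h x y) Pa XR.
  have [X2 [R2 XR2]] := IH2 _ _ _ _ _ Pb XR1.
  exists X2; split=> //; apply: reach_trans R1 _.
  by rewrite size_cat addnA.
Qed.

End Correct.

(** * Polynomial running time *)

Definition poly_bounded (f : nat -> nat) :=
  exists c d, forall m, 0 < m -> f m <= c * m ^ d.

Lemma poly_bounded_cst b : poly_bounded (fun=> b).
Proof. by exists b, 0 => m _; rewrite muln1. Qed.

(** Positivity of [m] lets both exponents be raised to their sum. *)
Lemma poly_bounded_add f g :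
  poly_bounded f -> poly_bounded g -> poly_bounded (fun m => f m + g m).
Proof.
move=> [c [d Hf]] [c' [d' Hg]]; exists (c + c'), (d + d') => m m0.
rewrite mulnDl leq_add //.
  by apply: leq_trans (Hf _ m0) _; rewrite leq_mul2l leq_pexp2l ?leq_addr ?orbT.
by apply: leq_trans (Hg _ m0) _; rewrite leq_mul2l leq_pexp2l ?leq_addl ?orbT.
Qed.

Lemma poly_bounded_mul f : poly_bounded f -> poly_bounded (fun m => m * f m).
Proof.
by move=> [c [d Hf]]; exists c, d.+1 => m m0; rewrite expnS mulnCA leq_mul2l Hf ?orbT.
Qed.

Lemma poly_bounded_ecost e : poly_bounded (ecost^~ e).
Proof.
by elim: e => /= *; repeat first [assumption | apply: poly_bounded_cst |
  apply: poly_bounded_mul | apply: poly_bounded_add].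
Qed.

Lemma poly_bounded_ccost c : poly_bounded (ccost^~ c).
Proof.
by elim: c => /= *; repeat first [assumption | apply: poly_bounded_ecost |
  apply: poly_bounded_cst | apply: poly_bounded_mul | apply: poly_bounded_add].
Qed.

(** [EPar 1] to [EPar 5] are 1, |Q|, |Sigma|, the initial state and |Q| + |Sigma|. *)
Definition params n k q0 := nth 0 [:: 0; 1; n; k; q0; n + k].

(** The header of 5 instructions consumes the three leading numbers of an encoding; [preg 0] is 0
    from the start. *)
Definition compile c : program :=
  [:: IConst (preg 1) 1; IRead (preg 2); IRead (preg 3); IRead (preg 4);
      IAdd (preg 5) (preg 2) (preg 3)] ++ ccmd 5 0 c.

Lemma compile_ok c n k q0 x t : 0 < n + k -> q0 <= n + k ->
  5 + ccost (n + k) c <= t ->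
  outputs_within (compile c) t [:: n, k, q0 & x]
    (out (den (params n k q0) [::] c (Store (fun=> 0) x [::]))).
Proof.
move=> nk0 q0le let_; set par := params n k q0.
have par_le p : par p <= par 5 by case: p => [|[|[|[|[|[|p]]]]]]; rewrite /par /params /= ?nth_nil; lia.
have P_at : code_at (compile c) 0 (compile c) by exists [::], [::]; rewrite cats0.
have /= := P_at; move=> /code_at_cons[P0 /code_at_cons[P1 /code_at_cons[P2]]].
move=> /code_at_cons[P3 /code_at_cons[P4 Pc]].
pose X1 := upd (upd (upd (upd (upd (fun=> 0) (preg 1) 1) (preg 2) n) (preg 3) k)
  (preg 4) q0) (preg 5) (n + k).
have XR : rep par [::] (fun=> 0) X1.
  split=> [p|//|a]; rewrite /X1; last by updE.
  case: p => [|[|[|[|[|[|p]]]]]]; updE => //.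
  by rewrite /par /params /= nth_nil.
have [X2 [R2 _]] := @ccmd_ok par (erefl _) (erefl _) par_le c _ 5 [::] X1 (Store (fun=> 0) x [::]) Pc XR.
have [n1 le1 E1] : reach (compile c) (5 + ccost (par 5) c) (start [:: n, k, q0 & x])
    (Config (size (compile c)) X2 (inp (den par [::] c (Store (fun=> 0) x [::])))
      (out (den par [::] c (Store (fun=> 0) x [::])))).
  apply: reach_step P0 _ => /=; apply: reach_step P1 _ => /=.
  apply: reach_step P2 _ => /=; apply: reach_step P3 _ => /=.
  apply: reach_step P4 _ => /=; updE.
  exact: R2.
(* The machine has halted after [n1] steps, and the surplus steps change nothing. *)
have [t' ->] : exists t', t = t' + n1.
  by exists (t - n1); rewrite subnK //; apply: leq_trans le1 let_.
rewrite /outputs_within iterD E1; set cf := Config _ _ _ _.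
have -> : iter t' (step (compile c)) cf = cf.
  by elim: t' => //= t' ->; rewrite /step onth_default.
by split=> //; rewrite /halted /=.
Qed.

Lemma run_poly c : exists C D, forall n k q0 x t, 0 < n + k -> q0 <= n + k ->
  C * (n + k) ^ D <= t ->
  outputs_within (compile c) t [:: n, k, q0 & x]
    (out (den (params n k q0) [::] c (Store (fun=> 0) x [::]))).
Proof.
have [C [D H]] := poly_bounded_add (poly_bounded_cst 5) (poly_bounded_ccost c).
exists C, D => n k q0 x t nk0 q0le le_t; apply: compile_ok => //.
exact: leq_trans (H _ nk0) le_t.
Qed.

(** * Computing strong equivalence *)

(** Truth is positivity, so addition is disjunction and [ESum] is existential quantification; [ENot]
    and [EAnd] moreover take only the values 0 and 1. *)
Definition ENot e := ESub (ECst 1) e.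
Definition EAnd e1 e2 := ENot (EAdd (ENot e1) (ENot e2)).
Definition EImp e1 e2 := EAdd (ENot e1) e2.
Definition EAll e := ENot (ESum (ENot e)).

(** The address of the entry (e1, e2, e3) of the array X.  An [ESum] whose body
    ignores the bound variable is a multiplication; because of these binders, the
    indices in e1 and e2 are shifted by 2 and by 1. *)
Definition Entry X e1 e2 e3 :=
  EAdd (ESum (EAdd (ESum (EAdd (ESum (ECst X)) e1)) e2)) e3.
Definition Rel X i j := EGet (Entry X (EVar i.+2) (EVar j.+1) (ECst 0)).
Definition Trans i a j := EGet (Entry 0 (EVar i.+2) (EVar a.+1) (EVar j)).
Definition SafeTrans i a j := EAnd (Trans i a j) (ESub (ECst 2) (Trans i a j)).
Definition AlphaTrans i a j := ESub (Trans i a j) (ECst 1).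

Definition loc m X x y z := m * (m * (m * X + x) + y) + z.

(** Uniqueness of digits in base [m]; the array number is the unbounded leading digit. *)
Lemma loc_inj m X x y z X' x' y' z' :
  x < m -> y < m -> z < m -> x' < m -> y' < m -> z' < m ->
  loc m X x y z = loc m X' x' y' z' -> [/\ X = X', x = x', y = y' & z = z'].
Proof.
have split_eq a b c d : b < m -> d < m -> m * a + b = m * c + d -> a = c /\ b = d.
  move=> bm dm; rewrite ![m * _]mulnC => E; have m0 : 0 < m by lia.
  have := congr1 (divn^~ m) E; rewrite !divnMDl // !divn_small // !addn0 => ac.
  by split=> //; move: E; rewrite ac => /addnI.
move=> xm ym zm xm' ym' zm' /(split_eq _ _ _ _ zm zm')[/(split_eq _ _ _ _ ym ym')[]].
by move=> /(split_eq _ _ _ _ xm xm')[-> ->] -> ->.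
Qed.

Lemma not_gt0 a : (0 < 1 - a) = ~~ (0 < a). Proof. lia. Qed.
Lemma and_gt0 a b : (0 < 1 - (1 - a + (1 - b))) = (0 < a) && (0 < b). Proof. lia. Qed.
Lemma and_val a b : 1 - (1 - a + (1 - b)) = (0 < a) && (0 < b). Proof. lia. Qed.
Lemma imp_gt0 a b : (0 < 1 - a + b) = (0 < a) ==> (0 < b). Proof. lia. Qed.

Lemma sum_gt0P m (f : nat -> nat) :
  reflect (exists2 x, x < m & 0 < f x) (0 < \sum_(0 <= x < m) f x).
Proof.
rewrite lt0n sum_nat_seq_neq0; apply: (iffP hasP) => [[x]|[x xm fx]].
  by rewrite mem_index_iota /= -lt0n => xm fx; exists x.
by exists x; rewrite ?mem_index_iota //= -lt0n.
Qed.

Lemma all_gt0P m (f : nat -> nat) :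
  reflect (forall x, x < m -> 0 < f x) (0 < 1 - \sum_(0 <= x < m) (1 - f x)).
Proof.
rewrite not_gt0; apply: (iffP negP) => [H x xm|H /sum_gt0P[x /H]]; last lia.
by rewrite lt0n; apply/negP => /eqP fx; apply/H/sum_gt0P; exists x; rewrite ?fx.
Qed.

Lemma map_enum_rank (T : finType) : [seq val (enum_rank x) | x <- enum T] = iota 0 #|T|.
Proof.
apply: (@eq_from_nth _ 0) => [|i]; rewrite size_map -cardE ?size_iota // => lti.
have [x0 _] : {x0 : T | true} by exists (enum_val (Ordinal lti)).
rewrite (nth_map x0) -?cardE // nth_iota //.
by rewrite -[nth x0 _ i]/(nth x0 _ (Ordinal lti)) -enum_val_nth enum_valK.
Qed.

(** * Formulas and commands on relations stored in the heap *)

Section Tables.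
Variables (Sigma Q : finType) (A : tNCW Sigma Q).
Local Notation n := #|Q|.
Local Notation k := #|Sigma|.
Local Notation m := (#|Q| + #|Sigma|).
Local Notation rk x := (val (enum_rank x)).
Let par := params n k (rk (init A)).
Implicit Types (q s : Q) (a : Sigma) (h : nat -> nat) (S : nat -> {set Q * Q}).

Lemma rkQ q : rk q < n. Proof. exact: ltn_ord. Qed.
Lemma rkQm q : rk q < m. Proof. exact/(leq_trans (rkQ q))/leq_addr. Qed.
Lemma rkS a : rk a < k. Proof. exact: ltn_ord. Qed.
Lemma rkSm a : rk a < m. Proof. exact/(leq_trans (rkS a))/leq_addl. Qed.
Lemma rk_inj (T : finType) (x y : T) : rk x = rk y -> x = y.
Proof. by move=> /val_inj/enum_rank_inj. Qed.
Lemma rk_ex (T : finType) i : i < #|T| -> exists x : T, i = rk x.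
Proof. by move=> lti; exists (enum_val (Ordinal lti)); rewrite enum_valK. Qed.

(** Array 0 holds the transition table; every other array holds a relation on
    states, of which only the entries below |Q| matter. *)
Definition rel_of h X : {set Q * Q} :=
  [set p : Q * Q | 0 < h (loc m X (rk p.1) (rk p.2) 0)].

(** Sums range below [m], beyond the numbers of states or letters; the second clause keeps spurious
    indices from looking like transitions. *)
Definition loaded h :=
  (forall q a s, h (loc m 0 (rk q) (rk a) (rk s)) = transition_code A q a s) /\
  (forall x b y, x < m -> b < m -> y < m -> 0 < h (loc m 0 x b y) ->
     [/\ x < n, b < k & y < n]).

Definition sat rho h e := 0 < eval par rho h e.

Lemma sat_Not rho h e : sat rho h (ENot e) = ~~ sat rho h e.
Proof. exact: not_gt0. Qed.

Lemma sat_And rho h e1 e2 : sat rho h (EAnd e1 e2) = sat rho h e1 && sat rho h e2.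
Proof. exact: and_gt0. Qed.

Lemma eval_And rho h e1 e2 : eval par rho h (EAnd e1 e2) = sat rho h (EAnd e1 e2).
Proof. by rewrite sat_And; apply: and_val. Qed.

Lemma sat_Imp rho h e1 e2 : sat rho h (EImp e1 e2) = sat rho h e1 ==> sat rho h e2.
Proof. exact: imp_gt0. Qed.

Lemma sat_Add rho h e1 e2 : sat rho h (EAdd e1 e2) = sat rho h e1 || sat rho h e2.
Proof. exact: addn_gt0. Qed.

Lemma sat_Sub rho h e1 e2 : sat rho h (ESub e1 e2) = (eval par rho h e2 < eval par rho h e1).
Proof. exact: subn_gt0. Qed.

Lemma sat_SumP rho h e :
  reflect (exists2 x, x < m & sat (x :: rho) h e) (sat rho h (ESum e)).
Proof. exact: sum_gt0P. Qed.

Lemma sat_AllP rho h e :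
  reflect (forall x, x < m -> sat (x :: rho) h e) (sat rho h (EAll e)).
Proof. exact: all_gt0P. Qed.

Definition satE := (sat_Not, sat_And, sat_Imp, sat_Add, sat_Sub).

Lemma eval_Rel rho h X i j :
  eval par rho h (Rel X i j) = h (loc m X (nth 0 rho i) (nth 0 rho j) 0).
Proof. by rewrite /= !sum_nat_const_nat !subn0. Qed.

Lemma eval_Trans rho h i b j : eval par rho h (Trans i b j) =
  h (loc m 0 (nth 0 rho i) (nth 0 rho b) (nth 0 rho j)).
Proof. by rewrite /= !sum_nat_const_nat !subn0. Qed.

Lemma sat_Rel rho h X i j q s : nth 0 rho i = rk q -> nth 0 rho j = rk s ->
  sat rho h (Rel X i j) = ((q, s) \in rel_of h X).
Proof. by rewrite inE /sat eval_Rel => -> ->. Qed.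

Section Loaded.
Variables (h : nat -> nat) (rho : seq nat).
Hypothesis hL : loaded h.

Lemma loaded_ex x b y : x < m -> b < m -> y < m -> 0 < h (loc m 0 x b y) ->
  exists q a s, [/\ x = rk q, b = rk a & y = rk s].
Proof.
move=> xm bm ym /(hL.2 _ _ _ xm bm ym)[/rk_ex[q ->] /rk_ex[a ->] /rk_ex[s ->]].
by exists q, a, s.
Qed.

Lemma transition_codeP q a s :
  [/\ (0 < transition_code A q a s) = (s \in delta A q a),
      (0 < transition_code A q a s < 2) = (s \in delta_safe A q a)
    & (1 < transition_code A q a s) = (s \in delta_alpha A q a)].
Proof.
by rewrite /transition_code !inE; case: (s \in delta A q a); case: (_ \in alpha A).
Qed.

Lemma sat_trans i b j q a s :
  nth 0 rho i = rk q -> nth 0 rho b = rk a -> nth 0 rho j = rk s ->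
  [/\ sat rho h (Trans i b j) = (s \in delta A q a),
      sat rho h (SafeTrans i b j) = (s \in delta_safe A q a)
    & sat rho h (AlphaTrans i b j) = (s \in delta_alpha A q a)].
Proof.
rewrite /SafeTrans /AlphaTrans !satE /sat eval_Trans => -> -> ->; rewrite hL.1.
by have [-> <- <-] := transition_codeP q a s.
Qed.

(** A satisfied transition atom guards the quantifiers: indices known only to be below [m] must be
    ranks. *)
Lemma trans_ex i b j :
  nth 0 rho i < m -> nth 0 rho b < m -> nth 0 rho j < m ->
  sat rho h (Trans i b j) || sat rho h (SafeTrans i b j) || sat rho h (AlphaTrans i b j) ->
  exists q a s, [/\ nth 0 rho i = rk q, nth 0 rho b = rk a & nth 0 rho j = rk s].
Proof.
rewrite /SafeTrans /AlphaTrans !satE /sat eval_Trans => lti ltb ltj H; apply: loaded_ex => //.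
by move: H => /= ; lia.
Qed.

End Loaded.

(** Under the two sums the context reads q', a, s, q; the universal quantifier puts s' in front, so
    index 3 denotes first q and then s. *)
Definition spoil_exp Y Z := ESum (ESum (EAnd (SafeTrans 3 1 0) (EAll
  (EAnd (EImp (SafeTrans 3 2 0) (Rel Z 1 0)) (EImp (AlphaTrans 3 2 0) (Rel Y 1 0)))))).

Lemma sat_spoil rho h Y Z q s : loaded h ->
  sat [:: rk s, rk q & rho] h (spoil_exp Y Z) =
  ((q, s) \in spoil A (rel_of h Y) (rel_of h Z)).
Proof.
move=> hL; apply/idP/spoilP.
  move=> /sat_SumP[b bm /sat_SumP[x xm]]; rewrite sat_And => /andP[safe].
  have [||||? [a [q' [_ /= ba xq]]]] := trans_ex (h := h)
    (rho := [:: x, b, rk s, rk q & rho]) hL (i := 3) (b := 1) (j := 0);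
    rewrite /= ?rkQm ?safe ?orbT //.
  move: safe; rewrite {}ba {}xq {b x bm xm} => safe /sat_AllP all_s.
  have [_ qq' _] := @sat_trans h [:: rk q', rk a, rk s, rk q & rho] hL 3 1 0 q a q'
    (erefl _) (erefl _) (erefl _).
  exists a, q'; split=> [|s' ss'|s' ss']; first by rewrite -qq'.
  1,2: have := all_s _ (rkQm s'); rewrite sat_And !sat_Imp => /andP[].
  1,2: have [_ E1 E2] := @sat_trans h [:: rk s', rk q', rk a, rk s, rk q & rho]
    hL 3 2 0 s a s' (erefl _) (erefl _) (erefl _).
  - by rewrite E1 ss' (@sat_Rel _ _ Z 1 0 q' s').
  - by rewrite E2 ss' (@sat_Rel _ _ Y 1 0 q' s').
move=> [a [q' [qq' H1 H2]]]; apply/sat_SumP; exists (rk a); first exact: rkSm.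
apply/sat_SumP; exists (rk q'); first exact: rkQm.
have [_ E _] := @sat_trans h [:: rk q', rk a, rk s, rk q & rho] hL 3 1 0 q a q'
    (erefl _) (erefl _) (erefl _).
rewrite sat_And E qq' /=; apply/sat_AllP => y ym.
(* If [y] is no successor of [s], both implications hold vacuously; otherwise it is the rank of a
   state. *)
have [Ht|] := boolP (sat [:: y, rk q', rk a, rk s, rk q & rho] h (SafeTrans 3 2 0) ||
    sat [:: y, rk q', rk a, rk s, rk q & rho] h (AlphaTrans 3 2 0)); last first.
  by rewrite negb_or sat_And !sat_Imp => /andP[/negbTE-> /negbTE->].
have [||||? [? [s' [_ _ /= ys]]]] := trans_ex (h := h)
    (rho := [:: y, rk q', rk a, rk s, rk q & rho]) hL (i := 3) (b := 2) (j := 0);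
    rewrite /= ?rkQm ?rkSm -?orbA ?Ht ?orbT //.
subst y; have [_ E1 E2] := @sat_trans h [:: rk s', rk q', rk a, rk s, rk q & rho]
    hL 3 2 0 s a s' (erefl _) (erefl _) (erefl _).
rewrite sat_And !sat_Imp E1 E2 (@sat_Rel _ _ Z 1 0 q' s') // (@sat_Rel _ _ Y 1 0 q' s') //.
by apply/andP; split; apply/implyP; [apply: H1 | apply: H2].
Qed.

Definition reach_exp Y N := EAdd (Rel Y 1 0) (ESum (ESum (ESum
  (EAnd (Trans 4 2 1) (EAnd (Trans 3 2 0) (Rel N 1 0)))))).

Lemma sat_reach rho h Y N q s : loaded h ->
  sat [:: rk s, rk q & rho] h (reach_exp Y N) =
  ((q, s) \in co_reach A (rel_of h Y) (rel_of h N)).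
Proof.
move=> hL; rewrite [RHS]inE sat_Add (@sat_Rel _ _ Y 1 0 q s) //; congr (_ || _).
have E q' a s' := And3
  (@sat_trans h [:: rk s', rk q', rk a, rk s, rk q & rho] hL 4 2 1 q a q'
     (erefl _) (erefl _) (erefl _))
  (@sat_trans h [:: rk s', rk q', rk a, rk s, rk q & rho] hL 3 2 0 s a s'
     (erefl _) (erefl _) (erefl _))
  (@sat_Rel [:: rk s', rk q', rk a, rk s, rk q & rho] h N 1 0 q' s'
     (erefl _) (erefl _)).
apply/sat_SumP/existsP => [[b bm /sat_SumP[x xm /sat_SumP[y ym]]]|[a]].
  rewrite !sat_And => /and3P[H1 H2 H3].
  have [||||? [a [q' [_ /= ba xq]]]] := trans_ex (h := h)
    (rho := [:: y, x, b, rk s, rk q & rho]) hL (i := 4) (b := 2) (j := 1);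
    rewrite /= ?rkQm ?H1 ?orbT //.
  have [||||? [? [s' [_ _ /= ys]]]] := trans_ex (h := h)
    (rho := [:: y, x, b, rk s, rk q & rho]) hL (i := 3) (b := 2) (j := 0);
    rewrite /= ?rkQm ?H2 ?orbT //.
  subst x y b; have [[E1 _ _] [E2 _ _] E3] := E q' a s'; exists a.
  apply/exists_inP; exists q'; rewrite -?E1 //.
  by apply/exists_inP; exists s'; rewrite -?E2 // -E3.
move=> /exists_inP[q' qq' /exists_inP[s' ss' qsN]]; exists (rk a); first exact: rkSm.
apply/sat_SumP; exists (rk q'); first exact: rkQm.
apply/sat_SumP; exists (rk s'); first exact: rkQm.
have [[E1 _ _] [E2 _ _] E3] := E q' a s'.
by rewrite !sat_And E1 E2 E3 qq' ss'.
Qed.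

Definition equiv_exp D N :=
  EAnd (ENot (Rel D 1 0)) (EAnd (ENot (Rel D 0 1))
    (EAnd (ENot (Rel N 1 0)) (ENot (Rel N 0 1)))).

Lemma sat_equiv rho h D N q s :
  sat [:: rk s, rk q & rho] h (equiv_exp D N) =
  [&& (q, s) \notin rel_of h D, (s, q) \notin rel_of h D,
      (q, s) \notin rel_of h N & (s, q) \notin rel_of h N].
Proof.
rewrite !sat_And !sat_Not (@sat_Rel _ _ D 1 0 q s) // (@sat_Rel _ _ D 0 1 s q) //.
by rewrite (@sat_Rel _ _ N 1 0 q s) // (@sat_Rel _ _ N 0 1 s q).
Qed.

(** The command assigns to the relation X a function of all relations, and may
    use those in Bs as scratch space. *)
Definition does c X (Bs : seq nat) (F : (nat -> {set Q * Q}) -> {set Q * Q}) :=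
  forall rho st, loaded (heap st) ->
  let st' := den par rho c st in
  [/\ loaded (heap st'), rel_of (heap st') X = F (rel_of (heap st)),
      forall Y, Y \notin X :: Bs -> rel_of (heap st') Y = rel_of (heap st) Y,
      inp st' = inp st & out st' = out st].

Definition indep (Bs : seq nat) (F : (nat -> {set Q * Q}) -> {set Q * Q}) :=
  forall S S', (forall Y, Y \notin Bs -> S Y = S' Y) -> F S = F S'.

Definition tab X e := CFor 2 (CFor 2 (CPut (Entry X (EVar 3) (EVar 1) (ECst 0)) e)).

Lemma foldl_nested (T : finType) (U : finType) R (f : R -> nat -> nat -> R) z :
  foldl (fun z i => foldl (fun z j => f z i j) z (iota 0 #|U|)) z (iota 0 #|T|) =
  foldl (fun z p => f z (rk p.1) (rk p.2)) z [seq (x, y) | x <- enum T, y <- enum U].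
Proof.
rewrite -!map_enum_rank; elim: (enum T) z => //= x l IH z.
rewrite foldl_cat -IH; congr (foldl _ _ _).
by elim: (enum U) z => //= y l' IH' z.
Qed.

(** The table is overwritten in place, so independence of [X] ensures that entries already written
    do not affect later ones; [X != 0] protects the transition table. *)
Lemma does_tab X e (F : (nat -> {set Q * Q}) -> {set Q * Q}) : X != 0 ->
  (forall rho h q s, loaded h ->
     sat [:: rk s, rk q & rho] h e = ((q, s) \in F (rel_of h))) ->
  indep [:: X] F -> does (tab X e) X [::] F.
Proof.
move=> X0 eF indF rho st hL; rewrite /tab.
rewrite [den _ _ _ _](@foldl_nested Q Q _
  (fun st x y => den par [:: y, x & rho] (CPut (Entry X (EVar 3) (EVar 1) (ECst 0)) e) st)).
set put := fun _ _ => _; set S := rel_of (heap st).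
have H l : forall st1, loaded (heap st1) ->
    (forall Y, Y \notin [:: X] -> rel_of (heap st1) Y = S Y) ->
  let st2 := foldl put st1 l in
  [/\ loaded (heap st2), forall Y, Y \notin [:: X] -> rel_of (heap st2) Y = S Y,
      forall p, (p \in rel_of (heap st2) X) =
        if p \in l then p \in F S else p \in rel_of (heap st1) X,
      inp st2 = inp st1 & out st2 = out st1].
  elim: l => [|[q s] l IH] st1 L1 S1 //=.
  have adr : eval par [:: rk s, rk q & rho] (heap st1)
      (Entry X (EVar 3) (EVar 1) (ECst 0)) = loc m X (rk q) (rk s) 0.
    by rewrite /= !sum_nat_const_nat !subn0.
  have heap_put : heap (put st1 (q, s)) = upd (heap st1) (loc m X (rk q) (rk s) 0)
      (eval par [:: rk s, rk q & rho] (heap st1) e) by rewrite -adr.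
  have m0 : 0 < m by exact: leq_ltn_trans (leq0n _) (rkQm q).
  have eval_rel Y p : (p \in rel_of (heap (put st1 (q, s))) Y) =
      if (Y == X) && (p == (q, s)) then (q, s) \in F S else p \in rel_of (heap st1) Y.
    rewrite [in LHS]inE heap_put /upd; case: eqP => [|ne].
      move=> /loc_inj[]; rewrite ?rkQm // => -> /rk_inj/= E1 /rk_inj/= E2 _.
      rewrite [p]surjective_pairing E1 E2 !eqxx -/(sat _ _ e) eF //=.
      by rewrite (indF (rel_of (heap st1)) S).
    rewrite [in RHS]inE; case: eqP => //= YX; case: eqP => // pE.
    by case: ne; rewrite YX pE.
  have [] := IH (put st1 (q, s)).
  - split=> [q' a s'|x b y xm bm ym]; rewrite heap_put /upd.
      case: eqP => [/loc_inj[]|_]; rewrite ?rkQm ?rkSm //; last exact: L1.1.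
      by move=> X0'; rewrite -X0' in X0.
    case: eqP => [/loc_inj[]|_]; rewrite ?rkQm ?rkSm //; last exact: L1.2.
    by move=> X0'; rewrite -X0' in X0.
  - move=> Y YX; rewrite -S1 //; apply/setP => p; rewrite eval_rel.
    by move: YX; rewrite inE => /negbTE->.
  move=> L2 S2 X2 i2 o2; split=> // p; rewrite X2 in_cons eval_rel eqxx /=.
  by case: (p \in l); [rewrite orbT | rewrite orbF; case: eqP => // ->].
have [//|L2 S2 X2 i2 o2] := H [seq (x, y) | x <- enum Q, y <- enum Q] st hL.
split=> //; apply/setP => -[q s]; rewrite X2 ifT //.
by apply/allpairsP; exists (q, s); rewrite !mem_enum.
Qed.

Definition set_rel (S : nat -> {set Q * Q}) X R := fun Y => if Y == X then R else S Y.

Lemma does_eq c X Bs F F' :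
  does c X Bs F -> (forall S, F S = F' S) -> does c X Bs F'.
Proof. by move=> H E rho st /(H rho)[? ? ? ? ?]; split; rewrite // -E. Qed.

(** The first command leaves arbitrary contents in [Bs], so the second must not depend on them. *)
Lemma does_seq c X Bs F c' X' Bs' F' : does c X Bs F -> does c' X' Bs' F' ->
  indep Bs F' -> {subset X :: Bs <= X' :: Bs'} ->
  does (CSeq c c') X' Bs' (fun S => F' (set_rel S X (F S))).
Proof.
move=> H H' ind sub rho st /(H rho)[L E K i o].
have [L' E' K' i' o'] := H' rho _ L; split; rewrite /= ?i' ?o' //.
- rewrite E'; apply: ind => Y YB; rewrite /set_rel; case: eqP => [->//|/eqP YX].
  by apply: K; rewrite inE negb_or YX.
- by move=> Y YB; rewrite K' // K //; apply: contra YB; apply: sub.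
Qed.

(** Since [does] holds under every environment, the body cannot depend on the loop variable, and the
    loop is plain iteration. *)
Lemma does_for c X Bs F : X \notin Bs -> does c X Bs F -> indep Bs F ->
  does (CFor 5 c) X Bs (fun S => iter m (fun R => F (set_rel S X R)) (S X)).
Proof.
move=> XB H ind rho st hL; move=> /=.
rewrite -[par 5]/m; set S := rel_of (heap st).
suff loop l : let st' := foldl (fun st x => den par (x :: rho) c st) st l in
  [/\ loaded (heap st'),
      rel_of (heap st') X = iter (size l) (fun R => F (set_rel S X R)) (S X),
      forall Y, Y \notin X :: Bs -> rel_of (heap st') Y = S Y,
      inp st' = inp st & out st' = out st].
  by have := loop (iota 0 m); rewrite size_iota.
elim/last_ind: l => [|l x IH]; first by split.
rewrite foldl_rcons size_rcons; move: IH; set st1 := foldl _ _ _.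
move=> [L1 E1 K1 i1 o1]; have [L2 E2 K2 i2 o2] := H (x :: rho) st1 L1.
split; rewrite ?i2 ?o2 //; last by move=> Y YB; rewrite K2 ?K1.
rewrite E2 iterS -E1; apply: ind => Y YB; rewrite /set_rel; case: eqP => [->//|/eqP YX].
by apply: K1; rewrite inE negb_or YX.
Qed.

(** One loop gives only [m] rounds; two give [m * m], enough for a fixpoint on pairs of states. *)
Lemma does_for2 c X Bs F : X \notin Bs -> does c X Bs F -> indep Bs F ->
  does (CFor 5 (CFor 5 c)) X Bs
    (fun S => iter (m * m) (fun R => F (set_rel S X R)) (S X)).
Proof.
move=> XB H ind.
have ext S S' R : (forall Y, Y \notin Bs -> S Y = S' Y) ->
    F (set_rel S X R) = F (set_rel S' X R).
  by move=> E; apply: ind => Y YB; rewrite /set_rel; case: eqP => // _; apply: E.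
have ind' : indep Bs (fun S => iter m (fun R => F (set_rel S X R)) (S X)).
  by move=> S S' E; rewrite (E X) //; apply: eq_iter => R; apply: ext.
apply: does_eq (does_for XB (does_for XB H ind) ind') _ => S.
have iterM x y f (R : {set Q * Q}) : iter (x * y) f R = iter x (iter y f) R.
  by elim: x => // x IH; rewrite mulSn iterD IH.
rewrite iterM; apply: eq_iter => R; rewrite /set_rel eqxx; apply: eq_iter => R'.
by apply: ind => Y YB; rewrite /set_rel; case: eqP.
Qed.

Lemma does_set0 X : X != 0 -> does (tab X (ECst 0)) X [::] (fun=> set0).
Proof. by move=> X0; apply: does_tab => // rho h q s _; rewrite inE. Qed.

Lemma does_setT X : X != 0 -> does (tab X (ECst 1)) X [::] (fun=> setT).
Proof. by move=> X0; apply: does_tab => // rho h q s _; rewrite inE. Qed.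

Lemma does_copy X B : X != 0 -> B != X ->
  does (tab X (Rel B 1 0)) X [::] (fun S => S B).
Proof.
move=> X0 BX; apply: does_tab => // [rho h q s _|S S' E].
  exact: sat_Rel.
by rewrite E // inE.
Qed.

(** As [e] may read [X], the new value is built in [B] and then copied. *)
Definition step_to X B e := CSeq (tab B e) (tab X (Rel B 1 0)).

Lemma does_step X B e (F : (nat -> {set Q * Q}) -> {set Q * Q}) :
  X != 0 -> B != 0 -> B != X ->
  (forall rho h q s, loaded h ->
     sat [:: rk s, rk q & rho] h e = ((q, s) \in F (rel_of h))) ->
  indep [:: B] F -> does (step_to X B e) X [:: B] F.
Proof.
move=> X0 B0 BX eF ind.
have H := does_tab B0 eF ind.
have HC : does (tab X (Rel B 1 0)) X [:: B] (fun S => S B).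
  move=> rho st hL; have [L E K i o] := does_copy X0 BX rho hL; split=> // Y YB.
  by apply: K; apply: contra YB; rewrite !inE => ->.
apply: does_eq (does_seq H HC _ _) _ => [S S' E|Y|S].
- exact: E.
- by rewrite !inE orbC => ->.
- by rewrite /set_rel eqxx.
Qed.

(** Relation 1 is the current approximation of [spoil_core], 2 of [spoil_once], 3 is
    the non-inclusion of safe languages, 4 the non-inclusion of languages, 5 strong
    equivalence; 6 makes the updates simultaneous. *)
Definition cmd_once := CSeq (tab 2 (ECst 0))
  (CFor 5 (CFor 5 (step_to 2 6 (spoil_exp 1 2)))).

Definition cmd_safe := CSeq (tab 1 (ECst 1)) (CSeq cmd_once (tab 3 (Rel 2 1 0))).

Definition cmd_core := CSeq (tab 1 (ECst 1))
  (CFor 5 (CFor 5 (CSeq cmd_once (tab 1 (Rel 2 1 0))))).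

Definition cmd_incl := CSeq cmd_core (CSeq (tab 4 (ECst 0))
  (CFor 5 (CFor 5 (step_to 4 6 (reach_exp 1 4))))).

Definition cmd_equiv := CSeq cmd_safe (CSeq cmd_incl (tab 5 (equiv_exp 3 4))).

Lemma does_weaken c X Bs Bs' F : does c X Bs F -> {subset Bs <= Bs'} -> does c X Bs' F.
Proof.
move=> H sub rho st /(H rho)[L E K i o]; split=> // Y YB; apply: K.
by apply: contra YB; rewrite !inE => /orP[->|/sub->]; rewrite ?orbT.
Qed.

Lemma does_once : does cmd_once 2 [:: 6] (fun S => spoil_once A (m * m) (S 1)).
Proof.
have H : does (step_to 2 6 (spoil_exp 1 2)) 2 [:: 6] (fun S => spoil A (S 1) (S 2)).
  apply: does_step => // [rho h q s hL|S S' E]; first exact: sat_spoil.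
  by rewrite !E.
apply: does_eq (does_seq (does_set0 (isT : 2 != 0)) (does_for2 _ H _) _ _) _ => //.
- by move=> S S' E; rewrite !E.
- by move=> S S' E; rewrite !E //; apply: eq_iter => R; rewrite /set_rel E.
- by move=> Y; rewrite !inE => ->.
Qed.

Lemma does_safe : does cmd_safe 3 [:: 1; 2; 6] (fun=> spoil_once A (m * m) setT).
Proof.
have H : does (CSeq cmd_once (tab 3 (Rel 2 1 0))) 3 [:: 1; 2; 6]
    (fun S => spoil_once A (m * m) (S 1)).
  apply: does_eq (does_seq does_once (does_weaken (does_copy _ _) _) _ _) _ => //.
  - by move=> S S' E; rewrite E.
  - by move=> Y; rewrite !inE => /orP[]/eqP->.
apply: does_eq (does_seq (does_setT (isT : 1 != 0)) H _ _) _ => //.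
- by move=> S S' E; rewrite E.
- by move=> Y; rewrite !inE => /eqP->.
Qed.

Lemma does_core : does cmd_core 1 [:: 2; 6] (fun=> spoil_core A (m * m)).
Proof.
have H : does (CSeq cmd_once (tab 1 (Rel 2 1 0))) 1 [:: 2; 6]
    (fun S => spoil_once A (m * m) (S 1)).
  apply: does_eq (does_seq does_once (does_weaken (does_copy _ _) _) _ _) _ => //.
  - by move=> S S' E; rewrite E.
  - by move=> Y; rewrite !inE => /orP[]/eqP->.
apply: does_eq (does_seq (does_setT (isT : 1 != 0)) (does_for2 _ H _) _ _) _ => //.
- by move=> S S' E; rewrite E.
- by move=> S S' E; rewrite E.
- by move=> Y; rewrite !inE => /eqP->.
Qed.

Lemma does_incl : does cmd_incl 4 [:: 1; 2; 6] (fun=> non_incl A (m * m)).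
Proof.
have H : does (step_to 4 6 (reach_exp 1 4)) 4 [:: 6] (fun S => co_reach A (S 1) (S 4)).
  apply: does_step => // [rho h q s hL|S S' E]; first exact: sat_reach.
  by rewrite !E.
have H' : does (CSeq (tab 4 (ECst 0)) (CFor 5 (CFor 5 (step_to 4 6 (reach_exp 1 4)))))
    4 [:: 6] (fun S => iter (m * m) (co_reach A (S 1)) set0).
  apply: does_eq (does_seq (does_set0 (isT : 4 != 0)) (does_for2 _ H _) _ _) _ => //.
  - by move=> S S' E; rewrite !E.
  - by move=> S S' E; rewrite !E //; apply: eq_iter => R; rewrite /set_rel E.
  - by move=> Y; rewrite !inE => /eqP->.
apply: does_eq (does_seq does_core (does_weaken H' _) _ _) _ => //.
- by move=> Y; rewrite !inE => /eqP->.
- by move=> S S' E; rewrite E.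
- by move=> Y; rewrite !inE => /or3P[]/eqP->.
Qed.

(** Relation 3 is computed first and survives [cmd_incl], which overwrites only 1, 2, 4 and 6. *)
Lemma does_equiv : does cmd_equiv 5 [:: 1; 2; 3; 4; 6]
  (fun=> [set p : Q * Q | strong_equivb A (m * m) p.1 p.2]).
Proof.
pose F (S : nat -> {set Q * Q}) (p : Q * Q) :=
  let: (q, s) := p in
  [&& (q, s) \notin S 3, (s, q) \notin S 3, (q, s) \notin S 4 & (s, q) \notin S 4].
have H : does (tab 5 (equiv_exp 3 4)) 5 [:: 1; 2; 4; 6] (fun S => [set p | F S p]).
  apply: (@does_weaken _ _ [::]) => //; apply: does_tab => // [rho h q s hL|S S' E].
    by rewrite sat_equiv [RHS]inE.
  by apply/setP => -[q s]; rewrite !inE /F !E.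
pose F' S (R : {set Q * Q}) := set_rel (set_rel S 3 R) 4 (non_incl A (m * m)).
have H' : does (CSeq cmd_incl (tab 5 (equiv_exp 3 4))) 5 [:: 1; 2; 4; 6]
    (fun S => [set p | F (F' S (S 3)) p]).
  apply: does_eq (does_seq does_incl H _ _) _ => //.
  - by move=> S S' E; apply/setP => -[q s]; rewrite !inE /F !E.
  - by move=> Y; rewrite !inE => /or4P[]/eqP->.
apply: does_eq (does_seq does_safe (does_weaken H' _) _ _) _ => //.
- by move=> Y; rewrite !inE => /or4P[]/eqP->.
- by move=> S S' E; apply/setP => -[q s]; rewrite !inE /F /F' /set_rel /= !E.
- by move=> Y; rewrite !inE => /or4P[]/eqP->.
- by move=> S; apply/setP => -[q s]; rewrite !inE.
Qed.

End Tables.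

(** * Reading the input and printing the quotient *)

Lemma flatten_if (T U : Type) (P : pred T) (g : T -> seq U) s :
  flatten [seq (if P x then g x else [::]) | x <- s] = flatten [seq g x | x <- s & P x].
Proof. by elim: s => //= x s ->; case: (P x). Qed.

Lemma flatten_allpairs (T U V W : Type) (f : T -> U -> V -> W) s u v :
  [seq f xy.1 xy.2 z | xy <- [seq (x, y) | x <- s, y <- u], z <- v] =
  flatten [seq flatten [seq flatten [seq [:: f x y z] | z <- v] | y <- u] | x <- s].
Proof.
have flat1 (g : V -> W) l : flatten [seq [:: g z] | z <- l] = map g l.
  by elim: l => //= z l ->.
elim: s => //= x s <-; rewrite allpairs_cat; congr (_ ++ _).
by rewrite allpairs_mapl; congr flatten; apply: eq_map => y; rewrite flat1.
Qed.

Lemma rk_index (T : finType) (x : T) : val (enum_rank x) = index x (enum T).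
Proof. by rewrite -{2}(nth_enum_rank x x) index_uniq ?enum_uniq // -cardE ltn_ord. Qed.

(** This gives the number of a class in the quotient by counting the representatives before its
    own. *)
Lemma index_filter (T : eqType) (P : pred T) (s : seq T) x : uniq s -> x \in s -> P x ->
  index x (filter P s) = count (fun y => P y && (index y s < index x s)) s.
Proof.
elim: s => //= z s IH /andP[zs us]; rewrite in_cons => /predU1P xs Px.
have [zx|zx] /= := eqVneq z x.
  subst z; rewrite Px /= !eqxx add0n.
  by rewrite (eq_count (a2 := pred0)) ?count_pred0 // => y /=; rewrite ltn0 andbF.
rewrite eqxx andbT; case: xs => [xz|xs]; first by rewrite xz eqxx in zx.
rewrite (_ : count _ s = count (fun y => P y && (index y s < index x s)) s).
  by case: (P z); rewrite /= ?(negbTE zx) IH.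
apply: eq_in_count => y ys; case: eqP => [zy|_]; last by rewrite ltnS.
by rewrite zy ys in zs.
Qed.

Lemma map_val_enum (T : finType) (P : pred T) :
  map val (enum {: {x : T | P x}}) = filter P (enum T).
Proof.
rewrite !enumT [in LHS]unlock /= (pmap_filter (insubK _)).
by apply: eq_filter => x; apply: isSome_insub.
Qed.

Definition ERepr i :=
  ENot (ESum (EAnd (ESub (EVar i.+1) (EVar 0)) (Rel 5 0 i.+1))).

(** [EAnd] contributes 0 or 1, so the sum counts; the comparison with [EPar 2] discards numbers that
    are not states. *)
Definition ECount e := ESum (EAnd (ESub (EPar 2) (EVar 0)) e).

(** Counts the representatives y such that no z <= y is equivalent to the initial
    state, that is, those before the representative of the initial state. *)
Definition EInitRank := ECount (EAnd (ERepr 0) (ENot (ESum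
  (EAnd (ENot (ESub (EVar 0) (EVar 1))) (EGet (Entry 5 (EVar 2) (EPar 4) (ECst 0))))))).

(** The double negation normalises to 0 or 1, as [ECode] needs to form the codes 1 and 2. The
    context is v, u, t, a, x, with u and v ranging over the classes of x and t. *)
Definition ESome e := ENot (ENot (ESum (ESum (EAnd (Rel 5 1 4) (EAnd (Rel 5 0 2) e))))).

Definition ECode := EAdd (ESome (SafeTrans 1 3 0))
  (EAdd (ESome (AlphaTrans 1 3 0)) (ESome (AlphaTrans 1 3 0))).

Definition cmd_read :=
  CFor 2 (CFor 3 (CFor 2 (CRead (Entry 0 (EVar 4) (EVar 2) (EVar 0))))).

Definition cmd_table :=
  CFor 2 (CIf (ERepr 0) (CFor 3 (CFor 2 (CIf (ERepr 0) (CPrint ECode))))).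

Definition cmd_print := CSeq (CPrint (ECount (ERepr 0)))
  (CSeq (CPrint (EPar 3)) (CSeq (CPrint EInitRank) cmd_table)).

Definition cmd_main := CSeq cmd_read (CSeq cmd_equiv cmd_print).

Definition table (Sigma Q : finType) (A : tNCW Sigma Q) :=
  [seq transition_code A qa.1 qa.2 s |
     qa <- [seq (q, a) | q <- enum Q, a <- enum Sigma], s <- enum Q].

Section InputOutput.
Variables (Sigma Q : finType) (A : tNCW Sigma Q).
Local Notation n := #|Q|.
Local Notation k := #|Sigma|.
Local Notation m := (#|Q| + #|Sigma|).
Local Notation rk x := (val (enum_rank x)).
Local Notation par := (params n k (rk (init A))).
Implicit Types (q s : Q) (a : Sigma) (h : nat -> nat).

(** The heap starts at 0 and only addresses of genuine triples are written, which gives the second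
    clause of [loaded]. *)
Lemma read_ok o :
  let st := den par [::] cmd_read (Store (fun=> 0) (table A) o) in
  [/\ loaded A (heap st), inp st = [::] & out st = o].
Proof.
move=> /=; rewrite -[par 2]/n -[par 3]/k.
pose rd st (p : Q * Sigma * Q) :=
  den par [:: rk p.2; rk p.1.2; rk p.1.1] (CRead (Entry 0 (EVar 4) (EVar 2) (EVar 0))) st.
pose L := [seq (qa, s) | qa <- [seq (q, a) | q <- enum Q, a <- enum Sigma], s <- enum Q].
set st := foldl _ _ _.
have -> : st = foldl rd (Store (fun=> 0) (table A) o) L.
  rewrite /st (@foldl_nested Q Sigma _ (fun st x b => foldl (fun st y =>
    den par [:: y; b; x] (CRead (Entry 0 (EVar 4) (EVar 2) (EVar 0))) st) st (iota 0 n))).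
  rewrite /L; elim: [seq (q, a) | q <- _, a <- _] (Store _ _ _) => //= p l IH z.
  rewrite foldl_cat IH; congr (foldl _ _ _).
  by rewrite -map_enum_rank; elim: (enum Q) z => //= y l' IH' z.
have adr q a s h : eval par [:: rk s; rk a; rk q] h (Entry 0 (EVar 4) (EVar 2) (EVar 0)) =
    loc m 0 (rk q) (rk a) (rk s).
  by rewrite /= !sum_nat_const_nat !subn0.
have H l : forall st1, inp st1 = [seq transition_code A p.1.1 p.1.2 p.2 | p <- l] ->
  let st2 := foldl rd st1 l in
  [/\ inp st2 = [::], out st2 = out st1,
      forall q a s, heap st2 (loc m 0 (rk q) (rk a) (rk s)) =
        if (q, a, s) \in l then transition_code A q a s
        else heap st1 (loc m 0 (rk q) (rk a) (rk s))
    & forall i, (forall q a s, i <> loc m 0 (rk q) (rk a) (rk s)) ->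
        heap st2 i = heap st1 i].
  elim: l => [|[[q a] s] l IH] [h x y] //= E; subst x.
  have [|-> -> Hin Hout] := IH (rd (Store h (transition_code A q a s ::
    [seq transition_code A p.1.1 p.1.2 p.2 | p <- l]) y) (q, a, s)) => //.
  have heap_rd : heap (rd (Store h (transition_code A q a s ::
      [seq transition_code A p.1.1 p.1.2 p.2 | p <- l]) y) (q, a, s)) =
      upd h (loc m 0 (rk q) (rk a) (rk s)) (transition_code A q a s) by rewrite -(adr q a s h).
  split=> // [q' a' s'|i ne].
    rewrite Hin in_cons heap_rd /upd; case: (_ \in l); first by rewrite orbT.
    rewrite orbF; case: eqP => [/loc_inj[]|ne]; rewrite ?rkQm ?rkSm //.
      by move=> _ /rk_inj-> /rk_inj-> /rk_inj->; rewrite eqxx.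
    by case: eqP => // -[E1 E2 E3]; case: ne; rewrite E1 E2 E3.
  by rewrite Hout // heap_rd /upd; case: eqP => // /ne.
have [|i' o' Hin Hout] := H L (Store (fun=> 0) (table A) o).
  by rewrite /table /L [RHS]map_allpairs.
split=> //; split=> [q a s|x b y xm bm ym].
  by rewrite Hin ifT //; apply/allpairsP; exists ((q, a), s); rewrite mem_enum; split=> //;
     apply/allpairsP; exists (q, a); rewrite !mem_enum.
case: (ltnP x n) => [xn|nx]; [case: (ltnP b k) => [bk|kb]; [case: (ltnP y n) => [//|ny]|]|].
all: rewrite Hout // => q a s /loc_inj[]; rewrite ?rkQm ?rkSm // => _ E1 E2 E3.
- by move: (rkQ s); rewrite -E3 ltnNge ny.
- by move: (rkS a); rewrite -E2 ltnNge kb.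
- by move: (rkQ q); rewrite -E1 ltnNge nx.
Qed.


Lemma eval_ECount rho h e (P : pred Q) :
  (forall q, sat A (rk q :: rho) h e = P q) ->
  eval par rho h (ECount e) = count P (enum Q).
Proof.
move=> eP.
have val_and x : eval par (x :: rho) h (EAnd (ESub (EPar 2) (EVar 0)) e) =
    ((x < n) && sat A (x :: rho) h e) by rewrite eval_And sat_And sat_Sub.
transitivity (\sum_(0 <= x < m) ((x < n) && sat A (x :: rho) h e : nat)).
  by apply: eq_bigr => x _; apply: val_and.
rewrite (big_cat_nat (n := n)) ?leq_addr //= -[RHS]addn0; congr (_ + _).
  rewrite /index_iota subn0 -map_enum_rank big_map -sum1_count [RHS]big_mkcond /=.
  by apply: eq_bigr => q _; rewrite eP rkQ /=; case: (P q).
by rewrite big_nat_cond big1 // => i; rewrite andbT => /andP[ni _]; rewrite ltnNge ni.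
Qed.

Lemma eval_Not2 rho h e : eval par rho h (ENot (ENot e)) = sat A rho h e.
Proof. rewrite /sat /=; lia. Qed.

(** * The printed encoding of the quotient *)

Section Printing.
Variables (e : rel Q) (h : nat -> nat).
Hypothesis eP : forall q s, reflect (strong_equiv A q s) (e q s).
Hypothesis hE : rel_of Sigma Q h 5 = [set p : Q * Q | e p.1 p.2].

Lemma sat_Rel5 rho i j q s : nth 0 rho i = rk q -> nth 0 rho j = rk s ->
  sat A rho h (Rel 5 i j) = e q s.
Proof. by move=> iq js; rewrite (sat_Rel A h 5 iq js) hE inE. Qed.

Lemma sat_ERepr rho i x : nth 0 rho i = rk x -> sat A rho h (ERepr i) = is_repr e x.
Proof.
move=> ix; rewrite sat_Not; apply/idP/forallP => [H y|H].
  apply/implyP => eyx; rewrite leqNgt; apply: contra H => yx.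
  apply/sat_SumP; exists (rk y); first exact: rkQm.
  by rewrite sat_And sat_Sub /= ix yx (@sat_Rel5 _ 0 i.+1 y x).
apply/sat_SumP => -[y ym]; rewrite sat_And sat_Sub /= ix => /andP[yx].
have [z E] : exists z : Q, y = rk z by apply: rk_ex; apply: ltn_trans yx (rkQ x).
subst y; rewrite (@sat_Rel5 _ 0 i.+1 z x) // => ezx.
by have /implyP/(_ ezx) := H z; rewrite leqNgt yx.
Qed.

Lemma eval_card rho : eval par rho h (ECount (ERepr 0)) = #|{: quot e}|.
Proof.
rewrite (@eval_ECount _ _ _ (is_repr e)) => [|q]; last exact: sat_ERepr.
by rewrite cardE -(size_map val) map_val_enum size_filter.
Qed.

Lemma repr_min x y : e y x -> rk (min_repr e x) <= rk y.
Proof.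
move=> yx; have /forallP/(_ y)/implyP := is_repr_min_repr eP x; apply.
by apply: (e_trans eP yx); rewrite (e_sym eP) (min_repr_e eP).
Qed.

(** Some z below or equal to y is equivalent to the initial state exactly when the least such state
    is below or equal to y; the remaining representatives precede it. *)
Lemma eval_init rho : eval par rho h EInitRank = rk (cls eP (init A)).
Proof.
pose P y := is_repr e y && (index y (enum Q) < index (min_repr e (init A)) (enum Q)).
rewrite (@eval_ECount _ _ _ P) => [|y].
  rewrite rk_index -(index_map val_inj) map_val_enum index_filter ?enum_uniq ?mem_enum //.
  exact: valP.
rewrite sat_And (@sat_ERepr _ 0 y) // /P -!rk_index; congr (_ && _).
rewrite sat_Not; apply/idP/idP => [|lt].
  rewrite ltnNge; apply: contra => le; apply/sat_SumP.
  exists (rk (min_repr e (init A))); first exact: rkQm.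
  rewrite sat_And sat_Not sat_Sub /= -leqNgt le /sat /= !sum_nat_const_nat !subn0.
  by have := min_repr_e eP (init A); have := hE; move/setP/(_ (min_repr e (init A), init A)); rewrite !inE => ->.
apply/sat_SumP => -[z zm]; rewrite sat_And sat_Not sat_Sub /= -leqNgt => /andP[zy].
have [w E] : exists w : Q, z = rk w by apply: rk_ex; apply: leq_ltn_trans zy (rkQ y).
subst z; rewrite /sat /= !sum_nat_const_nat !subn0 => H.
have /repr_min : e w (init A).
  by have := hE; move/setP/(_ (w, init A)); rewrite !inE => <-.
by move=> le; have := leq_trans le zy; rewrite leqNgt lt.
Qed.

Lemma den_CIf rho b c st :
  den par rho (CIf b c) st = if sat A rho (heap st) b then den par rho c st else st.
Proof. by []. Qed.

Lemma den_CPrint rho b i o :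
  den par rho (CPrint b) (Store h i o) = Store h i (rcons o (eval par rho h b)).
Proof. by []. Qed.

Lemma den_CSeq rho c c' st :
  den par rho (CSeq c c') st = den par rho c' (den par rho c st).
Proof. by []. Qed.

Lemma den_print_for (T : finType) p c rho i (g : T -> seq nat) : par p = #|T| ->
  (forall x o, den par (rk x :: rho) c (Store h i o) = Store h i (o ++ g x)) ->
  forall o, den par rho (CFor p c) (Store h i o) =
    Store h i (o ++ flatten [seq g x | x <- enum T]).
Proof.
move=> pT H o; rewrite [LHS]/= pT -map_enum_rank.
by elim: (enum T) o => [|x l IH] o /=; rewrite ?cats0 // H IH catA.
Qed.

Hypothesis niceA : nice A.
Hypothesis homA : alpha_homogenous A.
Hypothesis hL : loaded A h.
Local Notation C := (quotient eP).

(** By [quot_safeP] a single safe transition between members suffices, without inspecting the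
    alpha-transitions of the others. *)
Lemma sat_SomeSafe (x t : quot e) a :
  sat A [:: rk (val t); rk a; rk (val x)] h
    (ESum (ESum (EAnd (Rel 5 1 4) (EAnd (Rel 5 0 2) (SafeTrans 1 3 0))))) =
  (t \in delta_safe C x a).
Proof.
set rho := [:: _; _; _]; apply/sat_SumP/(quot_safeP eP niceA homA).
  move=> [i im /sat_SumP[j jm]]; rewrite 2!sat_And => /and3P[H1 H2 H3].
  have [||||u [b [v [/= iu ab jv]]]] := trans_ex (h := h) (rho := [:: j, i & rho])
    hL (i := 1) (b := 3) (j := 0); rewrite /= ?rkSm ?H3 ?orbT //.
  subst i j; exists u, v.
  rewrite -(@sat_Rel5 [:: rk v, rk u & rho] 1 4 u (val x)) // H1.
  rewrite -(@sat_Rel5 [:: rk v, rk u & rho] 0 2 v (val t)) // H2; split=> //.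
  by have [_ <- _] := @sat_trans _ _ A h [:: rk v, rk u & rho] hL 1 3 0 u a v
    (erefl _) (erefl _) (erefl _).
move=> [u [v [ux vt uv]]]; exists (rk u); first exact: rkQm.
apply/sat_SumP; exists (rk v); first exact: rkQm.
rewrite 2!sat_And (@sat_Rel5 _ 1 4 u (val x)) // (@sat_Rel5 _ 0 2 v (val t)) // ux vt /=.
by have [_ -> _] := @sat_trans _ _ A h [:: rk v, rk u & rho] hL 1 3 0 u a v
    (erefl _) (erefl _) (erefl _).
Qed.

Lemma sat_SomeAlpha (x t : quot e) a :
  sat A [:: rk (val t); rk a; rk (val x)] h
    (ESum (ESum (EAnd (Rel 5 1 4) (EAnd (Rel 5 0 2) (AlphaTrans 1 3 0))))) =
  (t \in delta_alpha C x a).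
Proof.
set rho := [:: _; _; _]; rewrite in_delta_alpha; apply/sat_SumP/quot_alphaP.
  move=> [i im /sat_SumP[j jm]]; rewrite 2!sat_And => /and3P[H1 H2 H3].
  have [||||u [b [v [/= iu ab jv]]]] := trans_ex (h := h) (rho := [:: j, i & rho])
    hL (i := 1) (b := 3) (j := 0); rewrite /= ?rkSm ?H3 ?orbT //.
  subst i j; exists u, v.
  rewrite -(@sat_Rel5 [:: rk v, rk u & rho] 1 4 u (val x)) // H1.
  rewrite -(@sat_Rel5 [:: rk v, rk u & rho] 0 2 v (val t)) // H2 -in_delta_alpha; split=> //.
  by have [_ _ <-] := @sat_trans _ _ A h [:: rk v, rk u & rho] hL 1 3 0 u a v
    (erefl _) (erefl _) (erefl _).
move=> [u [v [ux vt uv]]]; exists (rk u); first exact: rkQm.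
apply/sat_SumP; exists (rk v); first exact: rkQm.
rewrite 2!sat_And (@sat_Rel5 _ 1 4 u (val x)) // (@sat_Rel5 _ 0 2 v (val t)) // ux vt /=.
have [_ _ ->] := @sat_trans _ _ A h [:: rk v, rk u & rho] hL 1 3 0 u a v
    (erefl _) (erefl _) (erefl _).
by rewrite in_delta_alpha.
Qed.

Lemma eval_ECode (x t : quot e) a :
  eval par [:: rk (val t); rk a; rk (val x)] h ECode = transition_code C x a t.
Proof.
rewrite /ECode /ESome; set s1 := ENot _; set s2 := ENot (ENot (ESum (ESum
  (EAnd (Rel 5 1 4) (EAnd (Rel 5 0 2) (AlphaTrans 1 3 0)))))).
rewrite [LHS]/(eval par _ h s1 + (eval par _ h s2 + eval par _ h s2)).
rewrite !eval_Not2 sat_SomeSafe sat_SomeAlpha /transition_code.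
rewrite in_delta_safe [_ \in delta_alpha _ _ _]inE.
by case: (t \in _) => //; case: (_ \in alpha _).
Qed.

(** States that are not representatives print nothing, so the loops over [Q] amount to loops over
    the filtered enumeration, which is that of the quotient. *)
Lemma den_cmd_table i o :
  den par [::] cmd_table (Store h i o) = Store h i (o ++ table C).
Proof.
pose code q a s := eval par [:: rk s; rk a; rk q] h ECode.
rewrite (@den_print_for Q 2 _ [::] i (fun x => if is_repr e x then
    flatten [seq flatten [seq if is_repr e t then [:: code x a t] else [::] |
      t <- enum Q] | a <- enum Sigma] else [::]) (erefl _)).
  congr (Store _ _ (_ ++ _)); rewrite flatten_if -map_val_enum -map_comp.
  rewrite /table flatten_allpairs; congr flatten; apply: eq_map => x /=.
  congr flatten; apply: eq_map => a; rewrite flatten_if -map_val_enum -map_comp.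
  by congr flatten; apply: eq_map => t /=; rewrite /code eval_ECode.
move=> x {}o; rewrite den_CIf (@sat_ERepr _ 0 x) //.
case: ifP => _; last by rewrite cats0.
apply: (@den_print_for Sigma 3) => // a {}o.
apply: (@den_print_for Q 2) => // t {}o.
rewrite den_CIf (@sat_ERepr _ 0 t) //.
by case: ifP => _; rewrite ?cats0 // cats1.
Qed.

Lemma den_cmd_print :
  out (den par [::] cmd_print (Store h [::] [::])) = encode C.
Proof.
by rewrite /cmd_print 3!den_CSeq 3!den_CPrint eval_card eval_init den_cmd_table.
Qed.

End Printing.

Lemma den_cmd_main (e : rel Q) (eP : forall q s, reflect (strong_equiv A q s) (e q s)) :
  nice A -> alpha_homogenous A -> e =2 strong_equivb A (m * m) ->
  out (den par [::] cmd_main (Store (fun=> 0) (table A) [::])) = encode (quotient eP).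
Proof.
move=> niceA homA eE; rewrite /cmd_main 2!den_CSeq.
have := read_ok [::]; set st := den _ _ cmd_read _; move=> [hL ist ost].
have := does_equiv [::] hL; set st' := den _ _ cmd_equiv _; move=> [hL' E _ ist' ost'].
have hE : rel_of Sigma Q (heap st') 5 = [set p : Q * Q | e p.1 p.2].
  by rewrite E; apply/setP => p; rewrite !inE eE.
rewrite -(den_cmd_print eP hE niceA homA hL').
by case: st' ist' ost' {hL' E hE} => h i o /= -> ->; rewrite ist ost.
Qed.

End InputOutput.

(** With an empty alphabet the transition table is empty, but then reachability
    leaves a single state. *)
Lemma card_le_size_encode (Sigma Q : finType) (A : tNCW Sigma Q) :
  (forall q, reachable A q) -> #|Q| + #|Sigma| <= 2 * size (encode A).
Proof.
move=> reach; rewrite /encode size_cat !size_allpairs -!cardE /=.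
have n0 : 0 < #|Q| by apply/card_gt0P; exists (init A).
have [k0|k0] := posnP #|Sigma|; last first.
  have leQ : #|Q| <= #|Q| * #|Sigma| * #|Q| by rewrite leq_pmull // muln_gt0 n0.
  have leS : #|Sigma| <= #|Q| * #|Sigma| * #|Q|.
    by rewrite -mulnA mulnCA leq_pmulr // muln_gt0 n0.
  have double x y z : x <= z -> y <= z -> x + y <= 2 * (3 + z) by lia.
  exact: double.
rewrite k0 addn0 muln0 mul0n; suff /leq_trans-> : #|Q| <= 1 by [].
apply/card_le1_eqP => q s _ _.
suff init_only x : x = init A by rewrite (init_only q) (init_only s).
have /connectP[[|y p] /=] := reach x; first by [].
by case/andP=> /existsP[a]; have := fintype0 a; rewrite k0 => /(_ erefl).
Qed.

Theorem theorem3p20 :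
  exists (P : program) (c d : nat),
    forall (Sigma Q : finType) (B : tNCW Sigma Q),
      GFG B -> nice B -> safe_centralized B -> alpha_homogenous B ->
      exists (Q' : finType) (C : tNCW Sigma Q'),
        [/\ outputs_within P (c * size (encode B) ^ d + c) (encode B) (encode C),
            GFG C,
            forall w : nat -> Sigma, lang C w <-> lang B w
          & [/\ nice C, safe_centralized C, safe_minimal C
              & alpha_homogenous C]].
Proof.
have [C [D run]] := run_poly cmd_main.
(* The run takes at most [C * M ^ D] steps for [M] the number of states and letters, and [M] is at
   most twice the input length; hence the factor [2 ^ D]. *)
exists (compile cmd_main), (C * 2 ^ D), D => Sigma Q B _ niceB cenB homB.
have [reachB gfgB normB sdetB detB] := niceB.
set M := #|Q| + #|Sigma|.
have leM : #|{: Q * Q}| <= M * M by rewrite card_prod leq_mul ?leq_addr.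
have eP := strong_equivbP leM sdetB normB gfgB detB.
exists (quot (strong_equivb B (M * M))), (quotient eP); split.
- have n0 : 0 < #|Q| by apply/card_gt0P; exists (init B).
  rewrite -(den_cmd_main eP niceB homB (fun _ _ => erefl _)).
  have -> : encode B = [:: #|Q|, #|Sigma|, val (enum_rank (init B)) & table B] by [].
  apply: run; first by rewrite addn_gt0 n0.
    exact: ltnW (rkQm _ _).
  apply: leq_trans (leq_addr _ _); rewrite -mulnA -expnMn leq_mul2l; apply/orP; right.
  case: (posnP D) => [-> //|D0]; rewrite leq_exp2r //.
  exact: card_le_size_encode.
- exact: (quot_GFG eP niceB homB (init (quotient eP))).
- exact: (quot_lang eP niceB homB (init B)).
- split; [exact: quot_nice | exact: quot_safe_centralized | exact: quot_safe_minimal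
         | exact: quot_homogenous].
Qed.
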